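(* Let $V$ be a vector space of finite dimension $n$, let $1<k<n-1$, let $\mathfrak{M}=\mathbf{P}_k(V)$ be the Grassmann space of $k$-subspaces of $V$, and let $\mathcal{W}\subset\mathrm{Sub}_k(V)$ be a set of points whose index $\lambda=\mathrm{ind}_{\mathfrak{M}}(\mathcal{W})$ is a positive integer. Assume that (a) every line of $\mathfrak{M}$ has at least $2\lambda+2$ points; and (b) if $U$ is a point and $p$ is a line of $\mathfrak{M}$ such that $U\notin p$ and $U,p$ span some strong subspace, then there is a maximal strong subspace of $\mathfrak{M}$ that is not contained in $\mathcal{W}$, passes through $U$, and meets $p$. Then both $\mathfrak{M}$ and $\mathcal{W}$ can be recovered in the complement $\mathfrak{D}_{\mathfrak{M}}(\mathcal{W})$; that is, $\mathfrak{M}$ (points, lines, incidence) together with the point subset $\mathcal{W}$ is definable in terms of the incidence structure $\mathfrak{D}_{\mathfrak{M}}(\mathcal{W})$.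
   Context: $\mathrm{Sub}_k(V)$ is the set of $k$-dimensional subspaces of $V$. A $k$-pencil is a set $\mathbf{p}(H,B)=\{U\in\mathrm{Sub}_k(V): H\subset U\subset B\}$, where $H\in\mathrm{Sub}_{k-1}(V)$, $B\in\mathrm{Sub}_{k+1}(V)$, $H\subset B$; $\mathcal{P}_k(V)$ is the set of all $k$-pencils. The Grassmann space is the point-line space $\mathbf{P}_k(V)=\langle\mathrm{Sub}_k(V),\mathcal{P}_k(V)\rangle$ (points: $k$-subspaces; lines: $k$-pencils). A subspace of a point-line space is a set $X$ of points such that every line sharing at least two points with $X$ is contained in $X$; it is strong if any two of its points are collinear. The maximal strong subspaces of $\mathfrak{M}$ are the stars $\{U\in\mathrm{Sub}_k(V):H\subset U\}$ with $H\in\mathrm{Sub}_{k-1}(V)$ and the tops $\{U\in\mathrm{Sub}_k(V):U\subset B\}$ with $B\in\mathrm{Sub}_{k+1}(V)$. Index: for an integer $\lambda\ge0$, $\mathrm{ind}_{\mathfrak{M}}(\mathcal{W})=\lambda$ iff there is a line with exactly $\lambda$ points in $\mathcal{W}$ and every line either has at most $\lambda$ points in $\mathcal{W}$ or is contained in $\mathcal{W}$. Complement: $\mathfrak{D}_{\mathfrak{M}}(\mathcal{W})$ has point set $\mathrm{Sub}_k(V)\setminus\mathcal{W}$ (proper points) and line set $\{p\in\mathcal{P}_k(V): p\not\subseteq\mathcal{W}\}$ (proper lines), with incidence $\in$ restricted to these. It is regarded as a two-sorted structure with the incidence relation between proper points and proper lines only. Definable (recoverable) in the complement: constructible purely in terms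 of the points, lines and incidence of the complement. Precisely, there are parameter-free formulas in the language of point-line incidence, in variables for points, lines and sets of lines of the complement (quantification over all of these being allowed), the formulas not depending on the particular $\mathfrak{M}$ and $\mathcal{W}$, which define sorts (consisting of tuples of such objects, possibly modulo a definable equivalence relation) and relations of a structure isomorphic to $\mathfrak{M}$ with distinguished point subset $\mathcal{W}$, by an isomorphism which is the identity on proper points and proper lines. *)

(* Defs.v *)
From HB Require Import structures.
From mathcomp Require Import all_boot all_algebra.
From mathcomp Require Import boolp classical_sets functions cardinality.
Set Implicit Arguments.
Unset Strict Implicit.
Unset Printing Implicit Defensive.

Local Open Scope classical_set_scope.
Local Open Scope card_scope.

Record point_line_space := PointLineSpace {
  points : Type;
  lines : set (set points) }.

Section PointLineSpaces.
Variable M : point_line_space.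
Implicit Types (X Y W p : set (points M)) (U : points M).

Definition collinear U1 U2 : Prop := exists p, [/\ lines p, p U1 & p U2].

Definition subspace X : Prop :=
  forall p U1 U2, lines p -> U1 <> U2 ->
    p U1 -> p U2 -> X U1 -> X U2 -> p `<=` X.

Definition strong X : Prop :=
  subspace X /\ forall U1 U2, U1 <> U2 -> X U1 -> X U2 -> collinear U1 U2.

Definition maximal_strong X : Prop :=
  strong X /\ forall Y, strong Y -> X `<=` Y -> Y = X.

Definition span_subspace (A : set (points M)) : set (points M) :=
  \bigcap_(X in [set X | subspace X /\ A `<=` X]) X.

Definition has_index W (lambda : nat) : Prop :=
  (exists2 p, lines p & p `&` W #= `I_lambda) /\
  (forall p, lines p -> p `&` W #<= `I_lambda \/ p `<=` W).

End PointLineSpaces.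

Section Grassmann.
Variables (F : fieldType) (V : vectType F).

Definition Sub (k : nat) := {U : {vspace V} | \dim U == k}.

Definition pencil (k : nat) (H : Sub k.-1) (B : Sub k.+1) : set (Sub k) :=
  [set U | (val H <= val U)%VS /\ (val U <= val B)%VS].

Definition grassmann_space (k : nat) : point_line_space :=
  {| points := Sub k;
     lines := [set p | exists (H : Sub k.-1) (B : Sub k.+1),
                 (val H <= val B)%VS /\ p = pencil H B] |}.

End Grassmann.

Record incidence_structure := IncidenceStructure {
  ipoint : Type;
  iline : Type;
  incident : ipoint -> iline -> Prop }.

Definition complement (M : point_line_space) (W : set (points M)) :
    incidence_structure :=
  {| ipoint := {U : points M | ~ W U};
     iline := {p : set (points M) | lines p /\ ~ p `<=` W};
     incident := fun U p => sval p (sval U) |}.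

(* The language of point-line incidence, with variables for points, lines and
   sets of lines. Formulas are intrinsically scoped: [formula G] has its free
   variables among de Bruijn indices into the context [G], so there are no
   parameters, and empty sorts are harmless. Set quantifiers have full
   (standard) semantics. *)
Inductive kind := Point | Line | LineSet.

Inductive var : seq kind -> kind -> Type :=
| VZ G s : var (s :: G) s
| VS G s t : var G s -> var (t :: G) s.

Inductive formula (G : seq kind) : Type :=
| FInc : var G Point -> var G Line -> formula G
| FMem : var G Line -> var G LineSet -> formula G
| FEq s : var G s -> var G s -> formula G
| FNot : formula G -> formula G
| FAnd : formula G -> formula G -> formula G
| FOr : formula G -> formula G -> formula G
| FImp : formula G -> formula G -> formula G
| FEx s : formula (s :: G) -> formula G
| FAll s : formula (s :: G) -> formula G.

Section Semantics.
Variable D : incidence_structure.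

Definition carrier (s : kind) : Type :=
  match s with
  | Point => ipoint D
  | Line => iline D
  | LineSet => set (iline D)
  end.

Fixpoint env (G : seq kind) : Type :=
  if G is s :: G' then (carrier s * env G')%type else unit.

Fixpoint env_cat (G1 G2 : seq kind) : env G1 -> env G2 -> env (G1 ++ G2) :=
  match G1 return env G1 -> env G2 -> env (G1 ++ G2) with
  | [::] => fun _ e2 => e2
  | s :: G1' => fun e1 e2 => (e1.1, env_cat e1.2 e2)
  end.

Fixpoint lookup (G : seq kind) (s : kind) (v : var G s) : env G -> carrier s :=
  match v in var G s return env G -> carrier s with
  | VZ _ _ => fun e => e.1
  | VS _ _ _ v' => fun e => lookup v' e.2
  end.

Fixpoint sat (G : seq kind) (phi : formula G) : env G -> Prop :=
  match phi with
  | FInc x l => fun e => incident (lookup x e) (lookup l e)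
  | FMem l L => fun e => (lookup L e : set (iline D)) (lookup l e)
  | FEq _ x y => fun e => lookup x e = lookup y e
  | FNot a => fun e => ~ sat a e
  | FAnd a b => fun e => sat a e /\ sat b e
  | FOr a b => fun e => sat a e \/ sat b e
  | FImp a b => fun e => sat a e -> sat b e
  | FEx s a => fun e => exists x : carrier s, @sat (s :: G) a (x, e)
  | FAll s a => fun e => forall x : carrier s, @sat (s :: G) a (x, e)
  end.

End Semantics.

(* The syntactic data of an interpretation of a point-line space with a
   distinguished point set: points are the tuples of shape [pt_shape]
   satisfying [pt_dom], modulo [pt_eq]; likewise for lines. The formulas
   [pt_id] and [ln_id] say which tuples represent a given point, resp. line,
   of the ambient incidence structure. *)
Record interpretation := Interpretation {
  pt_shape : seq kind;
  pt_dom : formula pt_shape;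
  pt_eq : formula (pt_shape ++ pt_shape);
  ln_shape : seq kind;
  ln_dom : formula ln_shape;
  ln_eq : formula (ln_shape ++ ln_shape);
  inc_fm : formula (pt_shape ++ ln_shape);
  dist_fm : formula pt_shape;
  pt_id : formula (Point :: pt_shape);
  ln_id : formula (Line :: ln_shape) }.

(* The coordinate maps [f] and [g] induce, on the quotients of the defined
   domains by the defined equivalences, an isomorphism onto [M] with the point
   subset [W]; the last two clauses say that it is the identity on proper
   points and proper lines. *)
Definition recovers (I : interpretation) (M : point_line_space)
    (W : set (points M)) : Prop :=
  let D := complement W in
  exists (f : env D (pt_shape I) -> points M)
         (g : env D (ln_shape I) -> set (points M)),
    (forall U, exists2 t, sat (pt_dom I) t & f t = U) /\
    (forall t t', sat (pt_dom I) t -> sat (pt_dom I) t' ->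
       (sat (pt_eq I) (env_cat t t') <-> f t = f t')) /\
    (forall l, sat (ln_dom I) l -> lines (g l)) /\
    (forall p, lines p -> exists2 l, sat (ln_dom I) l & g l = p) /\
    (forall l l', sat (ln_dom I) l -> sat (ln_dom I) l' ->
       (sat (ln_eq I) (env_cat l l') <-> g l = g l')) /\
    (forall t l, sat (pt_dom I) t -> sat (ln_dom I) l ->
       (sat (inc_fm I) (env_cat t l) <-> g l (f t))) /\
    (forall t, sat (pt_dom I) t -> (sat (dist_fm I) t <-> W (f t))) /\
    (forall (U : ipoint D) t, sat (pt_dom I) t ->
       (@sat D (Point :: pt_shape I) (pt_id I) (U, t) <-> f t = sval U)) /\
    (forall (p : iline D) l, sat (ln_dom I) l ->
       (@sat D (Line :: ln_shape I) (ln_id I) (p, l) <-> g l = sval p)).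

(* Main.v *)
Require Import Defs.
From HB Require Import structures.
From mathcomp Require Import all_boot all_algebra.
From mathcomp Require Import boolp classical_sets functions cardinality.
From mathcomp Require Import zify.
Set Implicit Arguments.
Unset Strict Implicit.
Unset Printing Implicit Defensive.

Local Open Scope classical_set_scope.
Local Open Scope card_scope.

(** A point U of the Grassmann space, proper or not, is represented by its bundle,
the set of all proper lines through U.  What has to be defined from the incidence
of the complement is therefore: which sets of proper lines are bundles, and when
two bundles belong to collinear points.  The index is not available to the
formulas, so every definition is a closure property of configurations, and the
bound 2 * lambda + 2 only serves to show that enough configurations exist: two
conditions, each violated by at most lambda points of a line, leave at least two
points of that line.

A line of the Grassmann space is given by a pair (h, b), dim h = k - 1 and
dim b = k + 1.  The lines through U form a grid, with rows the hyperplanes h of U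
and columns the covers b of U; two of them lie in a common strong subspace exactly
when they share a row (a star) or a column (a top).

Bundles of improper points.  Two proper lines are parallel if they lie in a common
strong subspace and meet in an improper point; Veblen's configuration, two lines
through a proper point crossing both, expresses this (parE).  Parallelism alone
does not show that three coplanar lines are concurrent.  The second family of
strong subspaces does: four lines that form a rectangle of the grid, consecutive
ones parallel and opposite ones in no common strong subspace, have to pass through
one point (quad_concurrent).  A set of lines is a direction if those of its lines
that share a strong subspace are parallel, if it contains with two lines every
rectangle on them, and if it is connected by parallelism.  The decisive step is
star_concurrent: if a direction has two lines of a row h through U, it contains
those of their rectangles with a further row h', hence all proper lines of row h
through U whose column is proper in row h' too; a line of row h in the same plane
that avoids U would have to meet all of them in improper points, of which it has
too few.  So the maximal directions are the bundles of improper points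
(improper_bundleE).

Collinearity.  For two bundles sharing a proper line it is clear.  Otherwise one
uses that the common neighbours of two points at distance two form a grid whose
lines are the intersection of a star through one of the points with a top through
the other: if two adjacent points are both adjacent to u and v, and some proper
point is adjacent to the two but to neither u nor v, then u and v are collinear
(certified_sound).  Such witnesses exist when the star or the top spanned by u and
v contains a proper point (adj1_star).  If the star consists of improper points,
hypothesis (b) together with the index condition shows that few of the tops
through a point of a plane of the star are improper (few_inactive), and a second
round with these tops succeeds (adj2_complete).  Finally the line through two
collinear points consists of the points collinear with all common neighbours of
the two (thirdE).

Stars and tops are exchanged by duality.  The arguments are carried out in a
self-dual graded modular lattice, so that each one is given for stars or for tops only. *)
(** * The defining formulas *)

Section Predicates.
Variable D : incidence_structure.
Local Notation P := (carrier D Point).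
Local Notation L := (carrier D Line).
Local Notation B := (carrier D LineSet).
Implicit Types (x y a : P) (l m : L) (S T : B).

Definition crosses l1 l2 := exists x : P, incident x l1 /\ incident x l2.

(** Veblen's condition: [m1] and [m2] span a plane, which contains [l1] and
[l2]; these meet there, and not in a proper point. *)
Definition par l1 l2 :=
  ~ crosses l1 l2 /\
  exists (c : P) (m1 m2 : L),
    (incident c m1 /\ incident c m2) /\ (~ incident c l1 /\ ~ incident c l2) /\
    ~ m1 = m2 /\
    (crosses m1 l1 /\ crosses m1 l2) /\ (crosses m2 l1 /\ crosses m2 l2).

(** For proper lines this amounts to lying in a common maximal strong subspace,
see [costrongE]. *)
Definition costrong l1 l2 := forall x y : P,
  incident x l1 -> incident y l2 ->
  exists l : L, incident x l /\ incident y l.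

(** The lines [l1], [l2], [m2], [m1] are consecutive sides of a rectangle in the
grid of the lines through an improper point. *)
Definition quad l1 l2 m1 m2 :=
  (par l1 l2 /\ par m1 m2) /\ (par l1 m1 /\ par l2 m2) /\
  ~ costrong l1 m2 /\ ~ costrong l2 m1.

Definition parq l m := l = m \/ par l m.

Definition clique S := forall l m : L,
  S l -> S m -> costrong l m -> parq l m.

Definition quad_closed S := forall l1 l2 m1 m2 : L,
  S l1 -> S l2 -> quad l1 l2 m1 m2 -> S m1 /\ S m2.

(** Three steps suffice for all lines through an improper point: change the
column, then the row, then the column. *)
Definition linked S := forall l l' : L, S l -> S l' ->
  exists m m' : L, (S m /\ S m') /\ parq l m /\ parq m m' /\ parq m' l'.

Definition direction S :=
  clique S /\ quad_closed S /\ linked S /\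
  exists l l' : L, S l /\ S l' /\ ~ l = l'.

(** Maximality is needed because a connected part of a bundle that is closed
under rectangles can already be a direction. *)
Definition improper_bundle S :=
  direction S /\
  forall T : B, direction T -> (forall l : L, S l -> T l) ->
    forall l : L, T l -> S l.

Definition bundle_at x S := forall l : L,
  (S l -> incident x l) /\ (incident x l -> S l).

Definition proper_bundle S := exists x : P, bundle_at x S.

Definition bundle S := improper_bundle S \/ proper_bundle S.

Definition joined S T := exists l : L, S l /\ T l.

Definition reach x S := exists l : L, incident x l /\ S l.

(** Adjacent common neighbours [V1], [V2] of two points at distance two lie on a
line that is common to a star through one of these points and a top through the
other, so a proper neighbour [a] of [V1] and [V2] is adjacent to one of them.
The relation [R] is a test of collinearity that is already available. *)
Definition certified (R : B -> B -> Prop) S T :=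
  exists (V1 V2 : B) (a : P),
    (bundle V1 /\ bundle V2) /\ ~ V1 = V2 /\ R V1 V2 /\
    (R V1 S /\ R V1 T) /\ (R V2 S /\ R V2 T) /\
    (reach a V1 /\ reach a V2) /\ ~ reach a S /\ ~ reach a T.

(** Detects collinear points (or equal ones) that lie in a common maximal strong
subspace with a proper point. *)
Definition adj1 S T := joined S T \/ certified joined S T.

(** Detects all pairs of collinear or equal points. *)
Definition adj2 S T := adj1 S T \/ certified adj1 S T.

(** In a Grassmann space the points collinear or equal to all common neighbours
of two collinear points are those of the line that joins these. *)
Definition third S1 S2 T := forall Z : B, bundle Z ->
  adj2 Z S1 -> adj2 Z S2 -> adj2 Z T.

End Predicates.

Section Formulas.
Implicit Type G : seq kind.
Local Notation "^ v" := (VS _ v) (at level 8, format "^ v", right associativity).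
Local Notation x0 := (VZ _ _).
Local Notation x1 := (^x0).
Local Notation x2 := (^x1).
Local Notation x3 := (^x2).
Local Infix "&&&" := FAnd (at level 45, right associativity).
Local Infix "===>" := FImp (at level 55, right associativity).

(** Each formula below is built connective by connective as the predicate of the
same name without the initial letter, so that its satisfaction is convertible to
that predicate. *)
Definition fcrosses G (l1 l2 : var G Line) : formula G :=
  @FEx _ Point (FInc x0 ^l1 &&& FInc x0 ^l2).

Definition fpar G (l1 l2 : var G Line) : formula G :=
  FNot (fcrosses l1 l2) &&&
  @FEx _ Point (@FEx _ Line (@FEx _ Line
    ((FInc x2 x1 &&& FInc x2 x0) &&&
     (FNot (FInc x2 ^^^l1) &&& FNot (FInc x2 ^^^l2)) &&&
     FNot (FEq x1 x0) &&&
     (fcrosses x1 ^^^l1 &&& fcrosses x1 ^^^l2) &&&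
     (fcrosses x0 ^^^l1 &&& fcrosses x0 ^^^l2)))).

Definition fcostrong G (l1 l2 : var G Line) : formula G :=
  @FAll _ Point (@FAll _ Point
    (FInc x1 ^^l1 ===> FInc x0 ^^l2 ===>
     @FEx _ Line (FInc x2 x0 &&& FInc x1 x0))).

Definition fquad G (l1 l2 m1 m2 : var G Line) : formula G :=
  (fpar l1 l2 &&& fpar m1 m2) &&& (fpar l1 m1 &&& fpar l2 m2) &&&
  FNot (fcostrong l1 m2) &&& FNot (fcostrong l2 m1).

Definition fparq G (l m : var G Line) : formula G := FOr (FEq l m) (fpar l m).

Definition fclique G (S : var G LineSet) : formula G :=
  @FAll _ Line (@FAll _ Line
    (FMem x1 ^^S ===> FMem x0 ^^S ===> fcostrong x1 x0 ===> fparq x1 x0)).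

Definition fquad_closed G (S : var G LineSet) : formula G :=
  @FAll _ Line (@FAll _ Line (@FAll _ Line (@FAll _ Line
    (FMem x3 ^^^^S ===> FMem x2 ^^^^S ===> fquad x3 x2 x1 x0 ===>
     (FMem x1 ^^^^S &&& FMem x0 ^^^^S))))).

Definition flinked G (S : var G LineSet) : formula G :=
  @FAll _ Line (@FAll _ Line
    (FMem x1 ^^S ===> FMem x0 ^^S ===>
     @FEx _ Line (@FEx _ Line
       ((FMem x1 ^^^^S &&& FMem x0 ^^^^S) &&&
        fparq x3 x1 &&& fparq x1 x0 &&& fparq x0 x2)))).

Definition fdirection G (S : var G LineSet) : formula G :=
  fclique S &&& fquad_closed S &&& flinked S &&&
  @FEx _ Line (@FEx _ Line
    (FMem x1 ^^S &&& FMem x0 ^^S &&& FNot (FEq x1 x0))).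

Definition fimproper_bundle G (S : var G LineSet) : formula G :=
  fdirection S &&&
  @FAll _ LineSet
    (fdirection x0 ===>
     @FAll _ Line (FMem x0 ^^S ===> FMem x0 x1) ===>
     @FAll _ Line (FMem x0 x1 ===> FMem x0 ^^S)).

Definition fbundle_at G (x : var G Point) (S : var G LineSet) : formula G :=
  @FAll _ Line ((FMem x0 ^S ===> FInc ^x x0) &&& (FInc ^x x0 ===> FMem x0 ^S)).

Definition fproper_bundle G (S : var G LineSet) : formula G :=
  @FEx _ Point (fbundle_at x0 ^S).

Definition fbundle G (S : var G LineSet) : formula G :=
  FOr (fimproper_bundle S) (fproper_bundle S).

Definition fjoined G (S U : var G LineSet) : formula G :=
  @FEx _ Line (FMem x0 ^S &&& FMem x0 ^U).

Definition freach G (x : var G Point) (S : var G LineSet) : formula G :=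
  @FEx _ Line (FInc ^x x0 &&& FMem x0 ^S).

Definition fcertified (R : forall G, var G LineSet -> var G LineSet -> formula G)
    G (S U : var G LineSet) : formula G :=
  @FEx _ LineSet (@FEx _ LineSet (@FEx _ Point
    ((fbundle x2 &&& fbundle x1) &&& FNot (FEq x2 x1) &&& R _ x2 x1 &&&
     (R _ x2 ^^^S &&& R _ x2 ^^^U) &&& (R _ x1 ^^^S &&& R _ x1 ^^^U) &&&
     (freach x0 x2 &&& freach x0 x1) &&&
     FNot (freach x0 ^^^S) &&& FNot (freach x0 ^^^U)))).

Definition fadj1 G (S U : var G LineSet) : formula G :=
  FOr (fjoined S U) (fcertified fjoined S U).

Definition fadj2 G (S U : var G LineSet) : formula G :=
  FOr (fadj1 S U) (fcertified fadj1 S U).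

Definition fthird G (S1 S2 U : var G LineSet) : formula G :=
  @FAll _ LineSet
    (fbundle x0 ===> fadj2 x0 ^S1 ===> fadj2 x0 ^S2 ===> fadj2 x0 ^U).

(** Points are bundles, so their equality is equality of line sets; lines are
pairs of distinct collinear points. *)
Definition bundle_interpretation : interpretation :=
  @Interpretation
    [:: LineSet] (fbundle x0) (FEq x0 x1)
    [:: LineSet; LineSet]
      ((fbundle x0 &&& fbundle x1) &&& FNot (FEq x0 x1) &&& fadj2 x0 x1)
      (fthird x0 x1 x2 &&& fthird x0 x1 x3)
    (fthird x1 x2 x0) (FNot (fproper_bundle x0))
    (fbundle_at x0 x1) (FMem x0 x1 &&& FMem x0 x2).

End Formulas.

(** * Charts *)

Import GRing.Theory Num.Theory.
Local Open Scope ring_scope.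

(** Coordinates for a complement: a modular lattice whose rank function [lev] is
shifted so that points have level 0, feet of lines level -1 and roofs level 1.
With this normalization the axioms are invariant under reversing the order and
negating [lev].  [below] and [above] say that the ranks reach from -2 to 2, so
that stars and tops have dimension at least two. *)
Record chart (D : incidence_structure) := Chart {
  el : eqType;
  le : rel el;
  mt : el -> el -> el;
  jn : el -> el -> el;
  lev : el -> int;
  le_refl : reflexive le;
  le_trans : transitive le;
  mtP : forall x y z, le z (mt x y) = le z x && le z y;
  jnP : forall x y z, le (jn x y) z = le x z && le y z;
  lev_le : forall x y, le x y -> lev x <= lev y;
  lev_eq : forall x y, le x y -> lev x = lev y -> x = y;
  lev_mod : forall x y, lev (mt x y) + lev (jn x y) = lev x + lev y;
  interpolate : forall x y (i : int), le x y -> lev x <= i -> i <= lev y ->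
    exists z, [/\ le x z, le z y & lev z = i];
  relcompl : forall x y z, le x y -> le y z ->
    exists y', [/\ le x y', le y' z, mt y y' = x & jn y y' = z];
  below : forall x, - 2 <= lev x -> exists d, le d x /\ lev d = - 2;
  above : forall x, lev x <= 2 -> exists c, le x c /\ lev c = 2;
  horizon : el -> Prop;
  ind : nat;
  ind_gt0 : (0 < ind)%N;
  pt : ipoint D -> el;
  foot : iline D -> el;
  roof : iline D -> el;
  pt_lev : forall x, lev (pt x) = 0;
  pt_proper : forall x, ~ horizon (pt x);
  pt_inj : injective pt;
  pt_onto : forall u, lev u = 0 -> ~ horizon u -> exists x, pt x = u;
  foot_lev : forall l, lev (foot l) = - 1;
  roof_lev : forall l, lev (roof l) = 1;
  foot_roof : forall l, le (foot l) (roof l);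
  line_inj : forall l m, foot l = foot m -> roof l = roof m -> l = m;
  line_onto : forall h b x, lev h = - 1 -> lev b = 1 ->
    le h (pt x) -> le (pt x) b -> exists l, foot l = h /\ roof l = b;
  line_proper : forall l : iline D, exists x : ipoint D, incident x l;
  incE : forall (x : ipoint D) (l : iline D),
    incident x l <-> le (foot l) (pt x) /\ le (pt x) (roof l);
  horizon_few : forall l s, uniq s ->
    (forall u, u \in s ->
       [/\ lev u = 0, le (foot l) u, le u (roof l) & horizon u]) ->
    (size s <= ind)%N;
  line_big : forall h b, lev h = - 1 -> lev b = 1 -> le h b ->
    exists s, [/\ uniq s, (2 * ind + 2 <= size s)%N &
      forall u, u \in s -> [/\ lev u = 0, le h u & le u b]] }.

Declare Scope chart_scope.
Notation "x \sub y" := (le x y) (at level 70, no associativity) : chart_scope.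
Notation "x \cap y" := (mt x y) (at level 42, left associativity) : chart_scope.
Notation "x \cup y" := (jn x y) (at level 45, left associativity) : chart_scope.
Local Open Scope chart_scope.

Section Dual.
Variables (D : incidence_structure) (X : chart D).

(** Reversing the order exchanges feet with roofs and stars with tops, while the
incidence structure stays the same. *)
Definition dual : chart D.
Proof.
refine (@Chart D (el X) (fun x y => y \sub x) (@jn _ X) (@mt _ X)
  (fun x => - lev x) _ _ _ _ _ _ _ _ _ _ _ (@horizon _ X) (ind X)
  (ind_gt0 X) (pt X) (roof X) (foot X)
  _ (@pt_proper _ X) (@pt_inj _ X) _ _ _ (@foot_roof _ X) _ _
  (@line_proper _ X) _ _ _).
- exact: le_refl.
- by move=> y x z yx zy; exact: le_trans zy yx.
- by move=> x y z; exact: jnP.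
- by move=> x y z; exact: mtP.
- by move=> x y /lev_le; lia.
- by move=> x y yx e; apply/esym/(lev_eq yx); lia.
- by move=> x y; have := lev_mod x y; lia.
- move=> x y i yx xi iy.
  have [||z [yz zx zi]] := @interpolate _ X y x (- i) yx; try lia.
  by exists z; split=> //; lia.
- move=> x y z yx zy; have [y' [? ? ? ?]] := relcompl zy yx.
  by exists y'; split.
- move=> x x2; have [|c [xc c2]] := @above _ X x; first by lia.
  by exists c; split=> //; lia.
- move=> x x2; have [|c [xc c2]] := @below _ X x; first by lia.
  by exists c; split=> //; lia.
- by move=> x; rewrite pt_lev oppr0.
- by move=> u u0; apply: pt_onto; lia.
- by move=> l; rewrite roof_lev.
- by move=> l; rewrite foot_lev; lia.
- by move=> l m e1 e2; exact: (line_inj e2 e1).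
- move=> h b x h1 b1 xh bx.
  have [||l [e1 e2]] := @line_onto _ X b h x _ _ bx xh; try lia.
  by exists l.
- by move=> x l; split=> [/(incE X)[]|[a b]] ; [|apply/(incE X)].
- move=> l s us ins; apply: (@horizon_few _ X l) => // u /ins[u0 ? ? ?].
  by split=> //; lia.
- move=> h b h1 b1 bh; have [||s [us ss ins]] := @line_big _ X b h _ _ bh; try lia.
  by exists s; split=> // u /ins[u0 ? ?]; split=> //; lia.
Defined.

End Dual.

Section Lattice.
Variables (D : incidence_structure) (X : chart D).
Implicit Types (u v w x y z h b c d : el X).

Lemma mtl x y : x \cap y \sub x.
Proof. by have := mtP x y (x \cap y); rewrite le_refl => /esym/andP[]. Qed.

Lemma mtr x y : x \cap y \sub y.
Proof. by have := mtP x y (x \cap y); rewrite le_refl => /esym/andP[]. Qed.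

Lemma jnl x y : x \sub x \cup y.
Proof. by have := jnP x y (x \cup y); rewrite le_refl => /esym/andP[]. Qed.

Lemma jnr x y : y \sub x \cup y.
Proof. by have := jnP x y (x \cup y); rewrite le_refl => /esym/andP[]. Qed.

Lemma le_mt x y z : z \sub x -> z \sub y -> z \sub x \cap y.
Proof. by rewrite mtP => -> ->. Qed.

Lemma jn_le x y z : x \sub z -> y \sub z -> x \cup y \sub z.
Proof. by rewrite jnP => -> ->. Qed.

Lemma le_lev_eq x y : x \sub y -> lev y <= lev x -> x = y.
Proof. by move=> xy yx; apply: (lev_eq xy); have := lev_le xy; lia. Qed.

Lemma le_anti x y : x \sub y -> y \sub x -> x = y.
Proof. by move=> xy /lev_le; exact: le_lev_eq. Qed.

Lemma jnC x y : x \cup y = y \cup x.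
Proof. by apply: le_anti; apply: jn_le; rewrite ?jnl ?jnr. Qed.

Lemma sub_self x : x \sub x.
Proof. exact: le_refl. Qed.

Lemma sub_tr y x z : x \sub y -> y \sub z -> x \sub z.
Proof. exact: le_trans. Qed.

End Lattice.

(** Proves inequalities by lattice rules on meets and joins and by following
chains of hypotheses. *)
Ltac chain :=
  lazymatch goal with
  | |- is_true (?x \sub ?x) => exact (sub_self x)
  | |- is_true (_ \cup _ \sub _) => refine (jn_le _ _); chain
  | |- is_true (_ \sub _ \cap _) => refine (le_mt _ _); chain
  | |- _ =>
    match goal with
    | H : is_true (?x \sub ?y) |- is_true (?x \sub ?y) => exact H
    | |- is_true (foot _ ?l \sub roof _ ?l) => exact (foot_roof _ l)
    | |- is_true (?a \cap ?b \sub _) => refine (sub_tr (mtl a b) _); chain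
    | |- is_true (?a \cap ?b \sub _) => refine (sub_tr (mtr a b) _); chain
    | |- is_true (_ \sub ?a \cup ?b) => refine (sub_tr _ (jnl a b)); chain
    | |- is_true (_ \sub ?a \cup ?b) => refine (sub_tr _ (jnr a b)); chain
    | H : is_true (?x \sub ?z) |- is_true (?x \sub _) =>
      refine (sub_tr H _); clear H; chain
    end
  end.

Ltac lat := solve [chain].

(** Inequalities in the lattice are booleans, on which [lia] would split cases.
*)
Ltac lvl :=
  repeat match goal with H : is_true (_ \sub _) |- _ => clear H end; lia.

Section StarSpans.
Variables (D : incidence_structure) (X : chart D).
Implicit Types (u v w x y z h b c d : el X).

Lemma lev_meet x y z : z \sub x -> z \sub y -> lev z <= lev (x \cap y).
Proof. by move=> zx zy; apply/lev_le/le_mt. Qed.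

Lemma lev_join x y z : x \sub z -> y \sub z -> lev (x \cup y) <= lev z.
Proof. by move=> zx zy; apply/lev_le/jn_le. Qed.

Lemma lev_meet_lt x y : lev x = lev y -> x <> y -> lev (x \cap y) < lev x.
Proof.
move=> e n; have lex := lev_le (mtl x y).
have [e'|] := pselect (lev (x \cap y) = lev x); last by lia.
have ex : x \cap y = x by apply/(lev_eq (mtl x y)).
by case: n; apply/lev_eq => //; rewrite -ex mtr.
Qed.

Lemma lev_join_gt x y : lev x = lev y -> x <> y -> lev x < lev (x \cup y).
Proof.
by move=> e n; have := lev_meet_lt e n; have := lev_mod x y; lia.
Qed.

Lemma star_span h u v : lev h = - 1 -> lev u = 0 -> lev v = 0 -> u <> v ->
  h \sub u -> h \sub v -> u \cap v = h /\ lev (u \cup v) = 1.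
Proof.
move=> h1 u0 v0 n hu hv; have := lev_meet hu hv; have := lev_mod u v.
have := @lev_meet_lt u v; rewrite u0 v0 => /(_ erefl n) lt e ge.
by split; [apply/esym/le_lev_eq; [lat|lia] | lia].
Qed.

End StarSpans.

Section TopSpans.
Variables (D : incidence_structure) (X : chart D).
Implicit Types (u v w x y z h b c d : el X).

Lemma top_span b u v : lev b = 1 -> lev u = 0 -> lev v = 0 -> u <> v ->
  u \sub b -> v \sub b -> u \cup v = b /\ lev (u \cap v) = - 1.
Proof.
move=> b1 u0 v0 n ub vb.
have b1' : @lev _ (dual X) b = - 1 by rewrite /= b1.
have u0' : @lev _ (dual X) u = 0 by rewrite /= u0.
have v0' : @lev _ (dual X) v = 0 by rewrite /= v0.
have [e1 /= e2] := star_span b1' u0' v0' n ub vb.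
by split=> //; lia.
Qed.

Lemma meets_foot l u v : lev u = 0 -> lev v = 0 -> u <> v ->
  foot X l \sub u -> foot X l \sub v -> u \cap v = foot X l.
Proof.
by move=> u0 v0 n lu lv; have [] := star_span (foot_lev X l) u0 v0 n lu lv.
Qed.

Lemma joins_roof l u v : lev u = 0 -> lev v = 0 -> u <> v ->
  u \sub roof X l -> v \sub roof X l -> u \cup v = roof X l.
Proof.
by move=> u0 v0 n lu lv; have [] := top_span (roof_lev X l) u0 v0 n lu lv.
Qed.

(** For points: equal or collinear. *)
Definition adjq u v := lev (u \cup v) <= 1.

Lemma adjqC u v : adjq u v -> adjq v u.
Proof. by rewrite /adjq jnC. Qed.

Lemma adjq_meet u v : lev u = 0 -> lev v = 0 ->
  adjq u v <-> - 1 <= lev (u \cap v).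
Proof. by move=> u0 v0; rewrite /adjq; have := lev_mod u v; split; lia. Qed.

Lemma adjq_span u v : lev u = 0 -> lev v = 0 -> u <> v -> adjq u v ->
  lev (u \cap v) = - 1 /\ lev (u \cup v) = 1.
Proof.
move=> u0 v0 n uv; have := uv; rewrite adjq_meet // => ge.
have := lev_mod u v; have := @lev_meet_lt _ X u v.
by rewrite u0 v0 => /(_ erefl n); split; lia.
Qed.

Lemma adjq_star h u v : lev h = - 1 -> lev u = 0 -> lev v = 0 ->
  h \sub u -> h \sub v -> adjq u v.
Proof.
by move=> h1 u0 v0 hu hv; apply/adjq_meet => //; rewrite -h1; exact: lev_meet.
Qed.

Lemma adjq_top b u v : lev b = 1 -> u \sub b -> v \sub b -> adjq u v.
Proof. by move=> b1 ub vb; rewrite /adjq -b1; exact: lev_join. Qed.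

(** If the meets of [z] with [u] and with [v] differ, they span [z]; otherwise
this common meet lies below both [u] and [v]. *)
Lemma tri u v z : lev u = 0 -> lev v = 0 -> lev z = 0 -> u <> v -> adjq u v ->
  adjq z u -> adjq z v -> u \cap v \sub z \/ z \sub u \cup v.
Proof.
move=> u0 v0 z0 n uv zu zv.
have := zu; have := zv; have := uv; rewrite !adjq_meet // => m1 m2 m3.
have [e|ne] := pselect (lev ((z \cap u) \cap (z \cap v)) <= - 2).
  right; have := lev_mod (z \cap u) (z \cap v) => em.
  have <- : (z \cap u) \cup (z \cap v) = z.
    by apply/le_lev_eq; [lat|lia].
  lat.
left; have q : z \cap u \cap (z \cap v) \sub u \cap v by lat.
have := @lev_meet_lt _ X u v; rewrite u0 v0 => /(_ erefl n) lt.
by rewrite -(le_lev_eq q); [lat|lia].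
Qed.

End TopSpans.

(** * Counting along lines and perspectivities *)

Section Counting.

Lemma pick_two (T : eqType) (s : seq T) (m : nat) (P Q : T -> Prop) (e : T) :
  uniq s -> (2 * m + 2 <= size s)%N ->
  (forall s', uniq s' -> (forall x, x \in s' -> x \in s /\ P x) ->
     (size s' <= m)%N) ->
  (forall s', uniq s' -> (forall x, x \in s' -> x \in s /\ Q x) ->
     (size s' <= m)%N) ->
  exists x, [/\ x \in s, ~ P x, ~ Q x & x <> e].
Proof.
move=> us ss fP fQ; apply/not_existsP => none.
pose sP := [seq x <- s | `[< P x >]]; pose sQ := [seq x <- s | `[< Q x >]].
have lP : (size sP <= m)%N.
  by apply: fP => [|x]; [exact: filter_uniq | rewrite mem_filter => /andP[/asboolP]].
have lQ : (size sQ <= m)%N.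
  by apply: fQ => [|x]; [exact: filter_uniq | rewrite mem_filter => /andP[/asboolP]].
have : (size s <= size (e :: sP ++ sQ))%N.
  apply: uniq_leq_size => // x xs; rewrite inE mem_cat !mem_filter xs !andbT.
  apply/orP; have [->|ne] := pselect (x = e); [by left; exact: eqxx | right].
  apply/orP; have [p|np] := pselect (P x); [by left; apply/asboolP | right].
  by apply/asboolP; apply: contrapT => nq; apply: (none x).
by rewrite /= size_cat; lia.
Qed.

Variables (D : incidence_structure) (X : chart D).
Implicit Types (u v w x y z h b c d : el X) (l m : iline D).

(** Counted by duplicate-free sequences, since a line may have infinitely many
points. *)
Definition few h b (P : el X -> Prop) := forall s, uniq s ->
  (forall u, u \in s -> [/\ lev u = 0, h \sub u, u \sub b & P u]) ->
  (size s <= ind X)%N.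

Lemma few_horizon l : few (foot X l) (roof X l) (@horizon _ X).
Proof. exact: horizon_few. Qed.

Lemma few_eq h b v : few h b (eq^~ v).
Proof.
move=> s us ins; have := ind_gt0 X.
suff: (size s <= size [:: v])%N by move=> /=; lia.
by apply: uniq_leq_size => // u /ins[_ _ _ ->]; rewrite inE eqxx.
Qed.

Arguments few_eq : clear implicits.

Lemma few_none h b : few h b (fun=> False).
Proof.
move=> [|u s] // _ ins; have := ind_gt0 X.
by have [] := ins u (mem_head _ _).
Qed.

Arguments few_none : clear implicits.

(** Two exceptional sets of size at most [ind X] leave two of the at least [2 *
ind X + 2] points, hence one different from [e]. *)
Lemma pick h b (P Q : el X -> Prop) e : lev h = - 1 -> lev b = 1 -> h \sub b ->
  few h b P -> few h b Q ->
  exists u, [/\ lev u = 0, h \sub u, u \sub b & [/\ ~ P u, ~ Q u & u <> e]].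
Proof.
move=> h1 b1 hb fP fQ; have [s [us ss ins]] := line_big h1 b1 hb.
have few_in R : few h b R -> forall s', uniq s' ->
    (forall x, x \in s' -> x \in s /\ R x) -> (size s' <= ind X)%N.
  move=> fR s' us' ins'; apply: fR us' _ => u /ins'[/ins[? ? ?] ?].
  by split.
have [x [/ins[? ? ?] ? ? ?]] :=
  pick_two e us ss (few_in _ fP) (few_in _ fQ).
by exists x.
Qed.

Lemma third_point h b e e' : lev h = - 1 -> lev b = 1 -> h \sub b ->
  exists u, [/\ lev u = 0, h \sub u, u \sub b & u <> e /\ u <> e'].
Proof.
move=> h1 b1 hb.
have [u [? ? ? [? _ ?]]] := pick e' h1 b1 hb (few_eq h b e) (few_none h b).
by exists u.
Qed.

Lemma pick_proper l (Q : el X -> Prop) e : few (foot X l) (roof X l) Q ->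
  exists x : ipoint D, [/\ foot X l \sub pt X x, pt X x \sub roof X l,
    ~ Q (pt X x) & pt X x <> e].
Proof.
move=> fQ; have [u [u0 fu ur [/(pt_onto u0)[x ex] nq ne]]] :=
  pick e (foot_lev X l) (roof_lev X l) (foot_roof X l) (@few_horizon l) fQ.
by exists x; rewrite ex.
Qed.

Lemma third_proper l e e' : exists x : ipoint D, [/\ foot X l \sub pt X x,
  pt X x \sub roof X l, pt X x <> e & pt X x <> e'].
Proof. exact: pick_proper (few_eq _ _ e). Qed.

End Counting.
Arguments few_eq [D X] h b v.
Arguments few_none [D] X h b.

Section Perspectivity.
Variables (D : incidence_structure) (X : chart D).
Implicit Types (u v w x y z h b c d : el X) (l m : iline D).

Section Centre.
Variables (h u b : el X).
Hypotheses (h1 : lev h = - 1) (u0 : lev u = 0) (b1 : lev b = 1) (hu : h \sub u)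
  (ub : ~ u \sub b).

(** Joining the points of a line with a point [u] outside it is injective. *)
Lemma project x : lev x = 0 -> h \sub x -> x \sub b ->
  lev (u \cup x) = 1 /\ (u \cup x) \cap b = x.
Proof.
move=> x0 hx xb; have ne : u <> x by move=> e; apply: ub; rewrite e.
have [_ j1] := star_span h1 u0 x0 ne hu hx; split=> //.
apply/esym/le_lev_eq; first lat; rewrite x0.
have bn : u \cup x <> b by move=> e; apply: ub; rewrite -e; lat.
by have := @lev_meet_lt _ X (u \cup x) b; rewrite j1 b1 => /(_ erefl bn); lvl.
Qed.

Variable c : el X.
Hypotheses (c2 : lev c = 2) (uc : u \sub c) (bc : b \sub c).

(** The central projection with centre [u] between two lines whose roofs lie
below [c]; the image line may belong to another star. *)
Lemma project_onto x b' : lev x = 0 -> h \sub x -> x \sub b ->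
  lev b' = 1 -> b' \sub c -> ~ u \sub b' ->
  lev ((u \cup x) \cap b') = 0 /\ u \cup (u \cup x) \cap b' = u \cup x.
Proof.
move=> x0 hx xb b'1 b'c ub'; have [j1 _] := project x0 hx xb.
have bn : u \cup x <> b' by move=> e; apply: ub'; rewrite -e; lat.
have y0 : lev ((u \cup x) \cap b') = 0.
  have := @lev_meet_lt _ X (u \cup x) b'; rewrite j1 b'1 => /(_ erefl bn).
  have := lev_mod (u \cup x) b'.
  have := @lev_join _ X (u \cup x) b' c; rewrite jn_le //; last by lat.
  by move=> /(_ isT b'c); lvl.
split=> //; apply: le_lev_eq; first lat.
have un : u <> (u \cup x) \cap b' by move=> e; apply: ub'; rewrite e; lat.
by have := lev_join_gt _ un; rewrite u0 y0 => /(_ erefl); lvl.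
Qed.

(** Projecting a line from [u] to a proper line transports the bound on improper
points. *)
Lemma few_persp l : roof X l \sub c -> ~ u \sub roof X l -> foot X l \sub u ->
  few h b (fun x => horizon ((u \cup x) \cap roof X l)).
Proof.
move=> lc ul lu s us ins; set f := fun x => (u \cup x) \cap roof X l.
rewrite -(size_map f); apply: (@horizon_few _ X l).
  rewrite map_inj_in_uniq // => x y /ins[x0 hx xb _] /ins[y0 hy yb _] e.
  have [_ px] := project x0 hx xb; have [_ py] := project y0 hy yb.
  have [_ qx] := project_onto x0 hx xb (roof_lev X l) lc ul.
  have [_ qy] := project_onto y0 hy yb (roof_lev X l) lc ul.
  by rewrite -px -py -qx -qy -/(f x) -/(f y) e.
move=> _ /mapP[x /ins[x0 hx xb Wx] ->].
have [y0 _] := project_onto x0 hx xb (roof_lev X l) lc ul.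
by split=> //; rewrite /f; lat.
Qed.

End Centre.

Lemma proper_pt l : exists x : ipoint D,
  foot X l \sub pt X x /\ pt X x \sub roof X l.
Proof. by have [x /(incE X)[]] := line_proper X l; exists x. Qed.

Lemma line_through h u (x : ipoint D) : lev h = - 1 -> lev u = 0 ->
  u <> pt X x -> h \sub u -> h \sub pt X x ->
  exists l, foot X l = h /\ roof X l = u \cup pt X x.
Proof.
move=> h1 u0 n hu hx; have [_ j1] := star_span h1 u0 (pt_lev X x) n hu hx.
by apply: (line_onto h1 j1 hx); lat.
Qed.

(** In the plane between [h] and [c] some line through [x] misses [u]. *)
Lemma avoid h u x c : lev h = - 1 -> lev u = 0 -> lev c = 2 -> lev x = 0 ->
  u <> x -> h \sub u -> h \sub x -> u \sub c -> x \sub c ->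
  exists b, [/\ lev b = 1, x \sub b, b \sub c & ~ u \sub b].
Proof.
move=> h1 u0 c2 x0 n hu hx uc xc.
have [_ j1] := star_span h1 u0 x0 n hu hx.
have [b [xb bc e1 e2]] := relcompl (jnr u x) (jn_le uc xc).
have := lev_mod (u \cup x) b; rewrite e1 e2 c2 x0 j1 => e.
exists b; split=> //; first lvl.
move=> ub; apply: n; apply: (@le_lev_eq _ X); last by lvl.
by rewrite -e1; lat.
Qed.

Lemma span_two b b' u : lev b = 1 -> lev b' = 1 -> b <> b' -> lev u = 0 ->
  u \sub b -> u \sub b' -> b \cap b' = u /\ lev (b \cup b') = 2.
Proof.
move=> b1 b'1 n u0 ub ub'; have := lev_meet ub ub'; have := lev_mod b b'.
have := @lev_meet_lt _ X b b'; rewrite b1 b'1 => /(_ erefl n) lt e ge.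
by split; [apply/esym/le_lev_eq; [lat|lvl] | lvl].
Qed.

End Perspectivity.

(** * Parallel proper lines *)

Section Parallel.
Variables (D : incidence_structure) (X : chart D).
Implicit Types (u v w z h d : el X) (x y a b c : ipoint D) (l m : iline D).

(** Incidence for arbitrary points, while [incident] speaks about proper ones.
*)
Definition through u l := foot X l \sub u /\ u \sub roof X l.

(** Take a proper point [p] on a line that joins proper points of [l] and [m].
The lines through [p] meet [l] and [m] in at most [ind X] improper points each,
which leaves a second one crossing both lines properly. *)
Lemma par_star l m u : l <> m -> foot X l = foot X m -> lev u = 0 ->
  horizon u -> through u l -> through u m -> par l m.
Proof.
move=> n ef u0 Wu [fu ul] [_ um].
have bn : roof X l <> roof X m by move=> /(line_inj ef).
have [eu c2] := span_two (roof_lev X l) (roof_lev X m) bn u0 ul um.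
have disj x : ~ (pt X x \sub roof X l /\ pt X x \sub roof X m).
  move=> [xl xm]; apply: (@pt_proper _ X x).
  suff -> : pt X x = u by [].
  by apply: le_lev_eq; [rewrite -eu; lat | rewrite pt_lev u0].
have [a [ha al]] := proper_pt X l; have [b [hb bm]] := proper_pt X m.
have ab : pt X a <> pt X b by move=> e; apply: (disj a); rewrite {2}e.
rewrite -ef in hb.
have [m1 [f1 r1]] := line_through (foot_lev X l) (pt_lev X a) ab ha hb.
(* [p] is off [l] and [m]: those lines meet [m1] only in [a] and [b]. *)
have [p [fp rp pa pb]] := third_proper m1 (pt X a) (pt X b).
rewrite f1 in fp; rewrite r1 in rp.
have [_ j1] := star_span (foot_lev X l) (pt_lev X a) (pt_lev X b) ab ha hb.
have pl : ~ pt X p \sub roof X l.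
  move=> pl; apply: (disj b); split=> //.
  rewrite -(joins_roof (pt_lev X p) (pt_lev X a) pa pl al).
  have [-> _] := top_span j1 (pt_lev X p) (pt_lev X a) pa rp (jnl _ _).
  lat.
have pm : ~ pt X p \sub roof X m.
  move=> pm; apply: (disj a); split=> //.
  rewrite -(joins_roof (pt_lev X p) (pt_lev X b) pb pm bm).
  have [-> _] := top_span j1 (pt_lev X p) (pt_lev X b) pb rp (jnr _ _).
  lat.
have pc : pt X p \sub roof X l \cup roof X m by lat.
have cm := jnr (roof X l) (roof X m); have cl := jnl (roof X l) (roof X m).
have fm : foot X m \sub pt X p by rewrite -ef.
(* The line through [p] and [a2] is the second crossing line. *)
have [a2 [ha2 al2 nb ne]] := pick_proper (pt X a)
  (few_persp (foot_lev X l) (pt_lev X p) (roof_lev X l) fp pl c2 pc cl cm pm fm).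
have [y0 yj] := project_onto (foot_lev X l) (pt_lev X p) (roof_lev X l)
  fp pl c2 pc cl (pt_lev X a2) ha2 al2 (roof_lev X m) cm pm.
have [b2 eb] := pt_onto y0 nb.
have pa2 : pt X p <> pt X a2 by move=> e; apply: pl; rewrite e.
have [m2 [f2 r2]] := line_through (foot_lev X l) (pt_lev X p) pa2 fp ha2.
have i x k : foot X k \sub pt X x -> pt X x \sub roof X k -> incident x k.
  by move=> ? ?; apply/(incE X).
split; first by move=> [x [/(incE X)[_ xl] /(incE X)[_ xm]]]; apply: (disj x).
exists p, m1, m2; split.
  by split; apply: i; rewrite ?f1 ?r1 ?f2 ?r2 //; lat.
split; first by split=> /(incE X)[].
split.
  move=> e; apply: pl; move: r2; rewrite -e r1 => e2.
  have a2m : pt X a2 \sub pt X a \cup pt X b by rewrite e2; lat.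
  rewrite -(joins_roof (pt_lev X a2) (pt_lev X a) ne al2 al).
  by have [-> _] := top_span j1 (pt_lev X a2) (pt_lev X a) ne a2m (jnl _ _).
have fl := foot_roof X m.
split; split.
- by exists a; split; apply: i; rewrite ?f1 ?r1 //; lat.
- by exists b; split; apply: i; rewrite ?f1 ?r1 -?ef //; lat.
- by exists a2; split; apply: i; rewrite ?f2 ?r2 //; lat.
- exists b2; split; apply: i; rewrite ?f2 ?r2 -?ef ?eb //; lat.
Qed.

(** The lattice counterpart of parallelism. *)
Definition concurrent l m := l <> m /\
  (foot X l = foot X m \/ roof X l = roof X m) /\
  exists u, [/\ lev u = 0, horizon u, through u l & through u m].

(** The noncollinear points [c], [a1], [a2] lie in the star at the foot of [l],
so the plane they span is contained in this star, and it contains [m]; by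
modularity [l] and [m] meet in it. *)
Lemma concurrent_of_par_star l m c m1 m2 a1 a2 b1 b2 :
  ~ crosses l m -> m1 <> m2 ->
  incident c m1 -> incident c m2 -> ~ incident c l -> ~ incident c m ->
  incident a1 m1 -> incident a1 l -> incident b1 m1 -> incident b1 m ->
  incident a2 m2 -> incident a2 l -> incident b2 m2 -> incident b2 m ->
  foot X l \sub pt X c -> concurrent l m.
Proof.
move=> nm n12 c1 c2 cl cm a1m a1l b1m b1b a2m a2l b2m b2b hc.
have off a k : incident a k -> ~ incident c k -> pt X c <> pt X a.
  by move=> ik nk /pt_inj e; apply: nk; rewrite e.
have ca1 := off _ _ a1l cl; have ca2 := off _ _ a2l cl.
have cb1 := off _ _ b1b cm; have cb2 := off _ _ b2b cm.
have i x k : foot X k \sub pt X x -> pt X x \sub roof X k -> incident x k.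
  by move=> ? ?; apply/(incE X).
have meet2 x k k' : pt X c <> pt X x -> incident c k -> incident c k' ->
    incident x k -> incident x k' -> k = k'.
  move=> ne /(incE X)[cf cr] /(incE X)[cf' cr'] /(incE X)[xf xr].
  move=> /(incE X)[xf' xr'].
  apply: (@line_inj _ X).
    rewrite -(meets_foot (pt_lev X c) (pt_lev X x) ne cf xf).
    exact: (meets_foot (pt_lev X c) (pt_lev X x) ne cf' xf').
  rewrite -(joins_roof (pt_lev X c) (pt_lev X x) ne cr xr).
  exact: (joins_roof (pt_lev X c) (pt_lev X x) ne cr' xr').
have ne_of x y k k' : pt X x <> pt X c -> k <> k' -> incident c k ->
    incident c k' -> incident x k -> incident y k' -> pt X x <> pt X y.
  move=> nx nk ck ck' xk yk' /pt_inj e; apply: nk.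
  by apply: (@meet2 x) => //; [exact: nesym | rewrite e].
have a12 := ne_of _ _ _ _ (nesym ca1) n12 c1 c2 a1m a2m.
have b12 := ne_of _ _ _ _ (nesym cb1) n12 c1 c2 b1m b2m.
have n : l <> m by move=> e; apply: nm; exists a1; split; rewrite -?e.
case/(incE X): c1 => c1f c1r; case/(incE X): c2 => c2f c2r.
case/(incE X): a1m => a1f a1r; case/(incE X): a2m => a2f a2r.
case/(incE X): b1m => b1f b1r; case/(incE X): b2m => b2f b2r.
case/(incE X): a1l => a1lf a1lr; case/(incE X): a2l => a2lf a2lr.
case/(incE X): b1b => b1mf b1mr; case/(incE X): b2b => b2mf b2mr.
have L := pt_lev X.
have f1 : foot X m1 = foot X l.
  rewrite -(meets_foot (L c) (L a1) ca1 c1f a1f).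
  exact: (meets_foot (L c) (L a1) ca1 hc a1lf).
have f2 : foot X m2 = foot X l.
  rewrite -(meets_foot (L c) (L a2) ca2 c2f a2f).
  exact: (meets_foot (L c) (L a2) ca2 hc a2lf).
rewrite f1 in b1f; rewrite f2 in b2f.
have fm : foot X l = foot X m.
  rewrite -(meets_foot (L b1) (L b2) b12 b1mf b2mf).
  by rewrite (meets_foot (L b1) (L b2) b12 b1f b2f).
have rl := joins_roof (L a1) (L a2) a12 a1lr a2lr.
have rm := joins_roof (L b1) (L b2) b12 b1mr b2mr.
have r1 := joins_roof (L c) (L a1) ca1 c1r a1r.
have r2 := joins_roof (L c) (L a2) ca2 c2r a2r.
have bn : roof X l <> roof X m by move=> /(line_inj fm).
have cr : pt X c \cap roof X l = foot X l.
  apply/esym/le_lev_eq; first lat.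
  rewrite foot_lev.
  suff : lev (pt X c \cap roof X l) < 0 by lvl.
  have := lev_le (mtl (pt X c) (roof X l)); rewrite L => le0.
  have [e|] := pselect (lev (pt X c \cap roof X l) = 0); last by lvl.
  case: cl; apply: i => //.
  rewrite -(@lev_eq _ X _ (pt X c) (mtl _ (roof X l))) ?L //.
  lat.
have := lev_mod (pt X c) (roof X l); rewrite cr foot_lev L roof_lev => e2.
have : roof X l \cup roof X m \sub pt X c \cup roof X l.
  apply: jn_le; first lat.
  rewrite -rm; apply: jn_le.
    by apply: (sub_tr b1r); rewrite -r1; apply: jn_le; lat.
  by apply: (sub_tr b2r); rewrite -r2; apply: jn_le; lat.
move=> /lev_le e3.
have := @lev_meet_lt _ X (roof X l) (roof X m).
rewrite !roof_lev => /(_ erefl bn) lt.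
have := lev_mod (roof X l) (roof X m); rewrite !roof_lev => e4.
have u0 : lev (roof X l \cap roof X m) = 0 by lvl.
have fu : foot X l \sub roof X l \cap roof X m.
  by apply: le_mt; [|rewrite fm]; lat.
split=> //; split; first by left.
exists (roof X l \cap roof X m); split=> //.
- apply: contrapT => /(pt_onto u0)[x ex]; apply: nm; exists x.
  split; apply: i; rewrite ex -?fm //; lat.
- by split; lat.
- by split; rewrite -?fm; lat.
Qed.

End Parallel.

Section Duality.
Variables (D : incidence_structure) (X : chart D).
Implicit Types (u v w z h d : el X) (x y a b c : ipoint D) (l m : iline D).

Lemma dual_point u : lev u = 0 -> @lev _ (dual X) u = 0.
Proof. by move=> u0; rewrite /= u0. Qed.

Lemma dual_through u l : @through _ (dual X) u l <-> through u l.
Proof. by split=> -[]. Qed.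

Lemma dual_concurrent l m : concurrent (dual X) l m <-> concurrent X l m.
Proof.
split=> -[n [e [u [u0 Wu ul um]]]]; (split=> //; split; first by tauto).
  by exists u; split=> //; [move: u0 => /=; lia | exact/dual_through..].
by exists u; split=> //; [exact: dual_point | exact/dual_through..].
Qed.

Lemma line_unique l m u v : lev u = 0 -> lev v = 0 -> u <> v ->
  through u l -> through v l -> through u m -> through v m -> l = m.
Proof.
move=> u0 v0 n [a1 a2] [b1 b2] [c1 c2] [d1 d2]; apply: (@line_inj _ X).
  by rewrite -(meets_foot u0 v0 n a1 b1) (meets_foot u0 v0 n c1 d1).
by rewrite -(joins_roof u0 v0 n a2 b2) (joins_roof u0 v0 n c2 d2).
Qed.

Lemma incT x l : incident x l <-> through (pt X x) l.
Proof. exact: incE. Qed.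

Lemma adjq_on u v l : through u l -> through v l -> adjq u v.
Proof. by move=> [_ ul] [_ vl]; exact: adjq_top (roof_lev X l) ul vl. Qed.

Lemma tri_on u v z l : lev u = 0 -> lev v = 0 -> lev z = 0 -> u <> v ->
  through u l -> through v l -> adjq z u -> adjq z v ->
  foot X l \sub z \/ z \sub roof X l.
Proof.
move=> u0 v0 z0 n ul vl zu zv; have uv := adjq_on ul vl.
case: ul vl => uf ur [vf vr].
have := tri u0 v0 z0 n uv zu zv.
by rewrite (meets_foot u0 v0 n uf vf) (joins_roof u0 v0 n ur vr).
Qed.

Lemma star_foot l u v h : lev h = - 1 -> lev u = 0 -> lev v = 0 -> u <> v ->
  through u l -> through v l -> h \sub u -> h \sub v -> foot X l = h.
Proof.
move=> h1 u0 v0 n [ul _] [vl _] hu hv.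
rewrite -(meets_foot u0 v0 n ul vl).
by have [] := star_span h1 u0 v0 n hu hv.
Qed.

End Duality.

Section Top.
Variables (D : incidence_structure) (X : chart D).
Implicit Types (u v w z h d : el X) (x y a b c : ipoint D) (l m : iline D).

Lemma top_roof l u v d : lev d = 1 -> lev u = 0 -> lev v = 0 -> u <> v ->
  through u l -> through v l -> u \sub d -> v \sub d -> roof X l = d.
Proof.
move=> d1 u0 v0 n [_ ul] [_ vl] ud vd.
rewrite -(joins_roof u0 v0 n ul vl).
by have [] := top_span d1 u0 v0 n ud vd.
Qed.

(** The point [c] is adjacent to two points of [l], so it lies in the star or in
the top of [l]. *)
Lemma parE l m : par l m <-> concurrent X l m.
Proof.
split.
  move=> [nm [c [m1 [m2 [[c1 c2] [[cl cm] [n12 [[[a1 [a1m a1l]] [b1 [b1m b1b]]]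
    [[a2 [a2m a2l]] [b2 [b2m b2b]]]]]]]]]]].
  have off a k : incident a k -> ~ incident c k -> pt X c <> pt X a.
    by move=> ik nk /pt_inj e; apply: nk; rewrite e.
  have a12 : pt X a1 <> pt X a2.
    move=> /pt_inj e; apply: n12; apply: (@line_unique _ X _ _ (pt X c) (pt X a1)).
    - exact: pt_lev.
    - exact: pt_lev.
    - exact: off a1l cl.
    - exact/incT.
    - exact/incT.
    - exact/incT.
    - by apply/incT; rewrite e.
  have [||||hc|hc] := tri_on (pt_lev X a1) (pt_lev X a2) (pt_lev X c) a12 (l := l).
  - exact/incT.
  - exact/incT.
  - by apply: (@adjq_on _ X _ _ m1); apply/incT.
  - by apply: (@adjq_on _ X _ _ m2); apply/incT.
  - exact: (concurrent_of_par_star (X := X) nm n12 c1 c2 cl cm a1m a1l b1m b1b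
      a2m a2l b2m b2b hc).
  - apply/dual_concurrent.
    exact: (concurrent_of_par_star (X := dual X) nm n12 c1 c2 cl cm a1m a1l b1m b1b
      a2m a2l b2m b2b hc).
move=> [n [[e|e] [u [u0 Wu ul um]]]]; first exact: (par_star n e u0 Wu ul um).
apply: (@par_star _ (dual X) _ _ u n e (dual_point u0) Wu); exact/dual_through.
Qed.

Lemma par_intro l m u : l <> m -> foot X l = foot X m \/ roof X l = roof X m ->
  lev u = 0 -> horizon u -> through u l -> through u m -> par l m.
Proof. by move=> n e u0 Wu ul um; apply/parE; split=> //; split=> //; exists u. Qed.

Lemma costrong_foot l m : foot X l = foot X m -> costrong l m.
Proof.
move=> e x y xl ym; have [exy|n] := pselect (x = y).
  by exists l; rewrite -exy.
case/(incE X): (xl) => xf _; case/(incE X): ym => yf _; rewrite -e in yf.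
have nxy : pt X x <> pt X y by move=> /pt_inj.
have [k [fk rk]] := line_through (foot_lev X l) (pt_lev X x) nxy xf yf.
by exists k; split; apply/(incE X); rewrite fk rk; split; lat.
Qed.

Lemma costrong_sym l m : @costrong D l m -> @costrong D m l.
Proof. by move=> cs x y xm yl; have [k [? ?]] := cs y x yl xm; exists k. Qed.

End Top.

Section Costrong.
Variables (D : incidence_structure) (X : chart D).
Implicit Types (u v w z h d : el X) (x y a b c : ipoint D) (l m : iline D).

Lemma proper_on l (u v : el X) : exists x,
  [/\ through (pt X x) l, pt X x <> u & pt X x <> v].
Proof. by have [x [? ? ? ?]] := third_proper l u v; exists x. Qed.

(** Each of three proper points of [m] is adjacent to two points of [l], so it
lies in the star or in the top of [l]; two of the three lie in the same one. *)
Lemma costrongE l m : costrong l m <-> foot X l = foot X m \/ roof X l = roof X m.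
Proof.
split; last first.
  by case=> [|e]; [exact: costrong_foot | exact: (@costrong_foot _ (dual X))].
move=> cs; have [x [xl _ _]] := proper_on l (foot X l) (foot X l).
have [x' [x'l xx' _]] := proper_on l (pt X x) (pt X x).
have [y0 [y0m _ _]] := proper_on m (foot X m) (foot X m).
have [y1 [y1m n01 _]] := proper_on m (pt X y0) (pt X y0).
have [y2 [y2m n02 n12]] := proper_on m (pt X y0) (pt X y1).
have side y : through (pt X y) m ->
    foot X l \sub pt X y \/ pt X y \sub roof X l.
  move=> ym; apply: (tri_on (pt_lev X x') (pt_lev X x) (pt_lev X y) xx' x'l xl).
    have [k [/(incT X)? /(incT X)?]] :=
      cs x' y (iffRL (incT X _ _) x'l) (iffRL (incT X _ _) ym).
    exact: (@adjq_on _ X _ _ k).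
  have [k [/(incT X)? /(incT X)?]] :=
    cs x y (iffRL (incT X _ _) xl) (iffRL (incT X _ _) ym).
  exact: (@adjq_on _ X _ _ k).
have L := pt_lev X.
have F y y' : pt X y <> pt X y' -> through (pt X y) m -> through (pt X y') m ->
    foot X l \sub pt X y -> foot X l \sub pt X y' ->
    foot X l = foot X m \/ roof X l = roof X m.
  move=> n ym y'm fy fy'; left.
  by rewrite (star_foot (foot_lev X l) (L _) (L _) n ym y'm fy fy').
have R y y' : pt X y <> pt X y' -> through (pt X y) m -> through (pt X y') m ->
    pt X y \sub roof X l -> pt X y' \sub roof X l ->
    foot X l = foot X m \/ roof X l = roof X m.
  move=> n ym y'm fy fy'; right.
  by rewrite (top_roof (roof_lev X l) (L _) (L _) n ym y'm fy fy').
have [s0|s0] := side _ y0m; have [s1|s1] := side _ y1m.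
- exact: F n01 y1m y0m s1 s0.
- have [s2|s2] := side _ y2m; first exact: F n02 y2m y0m s2 s0.
  exact: R n12 y2m y1m s2 s1.
- have [s2|s2] := side _ y2m; first exact: F n12 y2m y1m s2 s1.
  exact: R n02 y2m y0m s2 s0.
- exact: R n01 y1m y0m s1 s0.
Qed.

(** In the grid at [u], the rows of [l] and [l'] have a common proper column
other than that of [l]: the columns improper in one of the rows correspond, by
projection from [u], to improper points of a proper line of that row. *)
Lemma common_roof l l' u : lev u = 0 -> horizon u -> through u l ->
  through u l' -> exists m m', [/\ foot X m = foot X l, foot X m' = foot X l',
    roof X m = roof X m' & roof X m <> roof X l /\ through u m /\ through u m'].
Proof.
move=> u0 Wu [ul ru] [ul' ru'].
have Wpt x : u <> pt X x by move=> e; apply: (@pt_proper _ X x); rewrite -e.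
have : lev (roof X l \cup roof X l') <= 2.
  have := lev_mod (roof X l) (roof X l'); have := lev_meet ru ru'.
  by rewrite !roof_lev u0; lvl.
move=> /above[p [lp p2]].
have lp1 : roof X l \sub p by apply: sub_tr lp; lat.
have lp2 : roof X l' \sub p by apply: sub_tr lp; lat.
have up : u \sub p by lat.
have [a [al ar]] := proper_pt X l; have [a' [al' ar']] := proper_pt X l'.
have ap : pt X a \sub p by lat.
have ap' : pt X a' \sub p by lat.
have [q [q1 aq qp uq]] :=
  avoid (foot_lev X l) u0 p2 (pt_lev X a) (Wpt a) ul al up ap.
have [q' [q'1 aq' qp' uq']] :=
  avoid (foot_lev X l') u0 p2 (pt_lev X a') (Wpt a') ul' al' up ap'.
have [k [fk rk]] := line_onto (foot_lev X l) q1 al aq.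
have [k' [fk' rk']] := line_onto (foot_lev X l') q'1 al' aq'.
have fq : foot X l \sub q by lat.
rewrite -rk in uq qp q1 fq; rewrite -rk' in uq' qp' q'1.
have fu' : foot X k' \sub u by rewrite fk'.
have few := few_persp (foot_lev X l) u0 q1 ul uq p2 up qp qp' uq' fu'.
rewrite -fk in few; have [x [fx xq nW nx]] := pick_proper (pt X a) few.
rewrite fk in fx.
have [j1 _] := project (foot_lev X l) u0 q1 ul uq (pt_lev X x) fx xq.
have [y0 _] := project_onto (foot_lev X l) u0 q1 ul uq p2 up qp (pt_lev X x)
  fx xq q'1 qp' uq'.
have [y ey] := pt_onto y0 nW.
have [m [fm rm]] := line_through (foot_lev X l) u0 (Wpt x) ul fx.
have yj : pt X y \sub u \cup pt X x by rewrite ey; lat.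
have fk'k := foot_roof X k'.
have fy : foot X l' \sub pt X y by rewrite ey -fk'; lat.
have [m' [fm' rm']] := line_onto (foot_lev X l') j1 fy yj.
exists m, m'; split=> //; first by rewrite rm.
split; last by split; split; rewrite ?fm ?fm' ?rm ?rm' //; lat.
rewrite rm => e; apply: uq; have xl : pt X x \sub roof X l by rewrite -e; lat.
have kl : through (pt X x) k by split; rewrite ?fk.
have ka : through (pt X a) k by split; rewrite ?fk ?rk.
by rewrite (top_roof (roof_lev X l) (pt_lev X x) (pt_lev X a) nx kl ka xl ar).
Qed.

End Costrong.

(** * Quadrangles and directions *)

Section Quads.
Variables (D : incidence_structure) (X : chart D).
Implicit Types (u v w z h d : el X) (x y a b c : ipoint D) (l m : iline D).

Lemma common_foot l l' u : lev u = 0 -> horizon u -> through u l ->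
  through u l' -> exists m m', [/\ roof X m = roof X l, roof X m' = roof X l',
    foot X m = foot X m' & foot X m <> foot X l /\ through u m /\ through u m'].
Proof.
move=> u0 Wu ul ul'.
have [m [m' [? ? ? [? [? ?]]]]] := @common_roof _ (dual X) l l' u (dual_point u0) Wu
  (iffRL (dual_through u l) ul) (iffRL (dual_through u l') ul').
by exists m, m'; split=> //; split=> //; split; exact/dual_through.
Qed.

Lemma quad_swap l1 l2 m1 m2 : @quad D l1 l2 m1 m2 -> quad l1 m1 l2 m2.
Proof.
move=> [[? ?] [[? ?] [? n]]]; split=> //; split=> //; split=> //.
by move=> /costrong_sym.
Qed.

Lemma quad_intro l1 l2 m1 m2 u : lev u = 0 -> horizon u ->
  foot X l1 = foot X l2 -> foot X m1 = foot X m2 ->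
  roof X m1 = roof X l1 -> roof X m2 = roof X l2 ->
  roof X l1 <> roof X l2 -> foot X m1 <> foot X l1 ->
  through u l1 -> through u l2 -> through u m1 -> through u m2 ->
  quad l1 l2 m1 m2.
Proof.
move=> u0 Wu fl fm r1 r2 nr nf ul1 ul2 um1 um2.
split; [split|split; [split|split]].
- by apply: (par_intro _ _ u0 Wu) => //; [congruence | left].
- by apply: (par_intro _ _ u0 Wu) => //; [congruence | left].
- by apply: (par_intro _ _ u0 Wu) => //; [congruence | right].
- by apply: (par_intro _ _ u0 Wu) => //; [congruence | right].
- by move=> /(costrongE X)[]; congruence.
- by move=> /(costrongE X)[]; congruence.
Qed.

(** Opposite sides share neither row nor column, so consecutive sides share
alternately a row and a column.  Hence [m1] and [m2] meet in the intersection of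
the roofs of [l1] and [l2]. *)
Lemma quad_concurrent l1 l2 m1 m2 u : quad l1 l2 m1 m2 ->
  foot X l1 = foot X l2 -> lev u = 0 -> through u l1 -> through u l2 ->
  through u m1 /\ through u m2.
Proof.
move=> [[p12 q12] [[p1 p2] [n12 n21]]] fl u0 [f1 r1] [f2 r2].
have {}n12 : ~ (foot X l1 = foot X m2 \/ roof X l1 = roof X m2).
  by move=> /(costrongE X).
have {}n21 : ~ (foot X l2 = foot X m1 \/ roof X l2 = roof X m1).
  by move=> /(costrongE X).
have [_ [[e1|e1] _]] := iffLR (parE X _ _) p1; first by case: n21; left; rewrite -fl.
have [_ [[e2|e2] _]] := iffLR (parE X _ _) p2; first by case: n12; left; rewrite fl.
have [_ [_ [v [v0 _ [vf1 vr1] [vf2 vr2]]]]] := iffLR (parE X _ _) q12.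
have nr : roof X l1 <> roof X l2 by move=> e; apply: n12; right; rewrite e.
have [e _] := span_two (roof_lev X l1) (roof_lev X l2) nr u0 r1 r2.
have -> : u = v.
  apply/esym/le_lev_eq; last by rewrite u0 v0.
  by rewrite -e e1 e2; lat.
by split.
Qed.

(** Suppose [l3] misses [u].  It meets [l1] and [l2], so it lies in their plane.
The rectangles on [l1] and [l2] supply [m1] in a second row.  For each proper
point [x] of [l3], the line [n] that joins [x] with [u] is in [S] as soon as its
column is proper in the row of [m1]; but [n] meets [l3] in the proper point [x],
against the clique condition.  At most [ind X] points of [l3] are improper, and
as many give an improper column. *)
Lemma star_concurrent (S : set (iline D)) l1 l2 l3 u :
  clique S -> quad_closed S -> S l1 -> S l2 -> S l3 -> l1 <> l2 ->
  foot X l1 = foot X l2 -> foot X l1 = foot X l3 ->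
  lev u = 0 -> horizon u -> through u l1 -> through u l2 -> through u l3.
Proof.
move=> cS qS S1 S2 S3 n12 f12 f13 u0 Wu ul1 ul2.
have [//|nu] := pselect (through u l3).
have Wpt x : u <> pt X x by move=> e; apply: (@pt_proper _ X x); rewrite -e.
have uf3 : foot X l3 \sub u by rewrite -f13; case: ul1.
have u3 : ~ u \sub roof X l3 by move=> u3; apply: nu.
have c3 l : S l -> foot X l = foot X l3 -> through u l ->
    l3 <> l /\ exists v, [/\ lev v = 0, through v l3 & through v l].
  move=> Sl fl ul; have n3 : l3 <> l by move=> e; apply: nu; rewrite e.
  split=> //; have [//|/(parE X)[_ [_ [v [v0 _ ? ?]]]]] :=
    cS _ _ S3 Sl (costrong_foot (esym fl)).
  by exists v.
have [n31 [v1 [v10 v1l3 v1l1]]] := c3 _ S1 f13 ul1.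
have [n32 [v2 [v20 v2l3 v2l2]]] := c3 _ S2 (etrans (esym f12) f13) ul2.
have nr : roof X l1 <> roof X l2 by move=> /(line_inj f12).
have [eu p2] := span_two (roof_lev X l1) (roof_lev X l2) nr u0 ul1.2 ul2.2.
have n12v : v1 <> v2.
  move=> e; apply: u3; have -> : u = v1.
    apply/esym/le_lev_eq; last by rewrite u0 v10.
    by rewrite -eu; apply: le_mt; [exact: v1l1.2 | rewrite e; exact: v2l2.2].
  exact: v1l3.2.
set p := _ \cup _ in p2.
have r3p : roof X l3 \sub p.
  rewrite -(joins_roof v10 v20 n12v v1l3.2 v2l3.2); rewrite /p.
  by have r1 := v1l1.2; have r2 := v2l2.2; lat.
have [m1 [m2 [r1 r2 fm [nf [um1 um2]]]]] := common_foot u0 Wu ul1 ul2.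
have q0 := quad_intro u0 Wu f12 fm r1 r2 nr nf ul1 ul2 um1 um2.
have [Sm1 Sm2] := qS _ _ _ _ S1 S2 q0.
have [a [fa ra]] := proper_pt X m1.
have r1p : roof X m1 \sub p by rewrite r1 /p; lat.
have ap : pt X a \sub p by lat.
have up : u \sub p by have := um1.2; move=> H; lat.
have [q [q1 aq qp uq]] :=
  avoid (foot_lev X m1) u0 p2 (pt_lev X a) (Wpt a) um1.1 fa up ap.
have [k [fk rk]] := line_onto (foot_lev X m1) q1 fa aq.
rewrite -rk in q1 aq qp uq.
have fku : foot X k \sub u by rewrite fk; case: um1.
(* The line [k] is a proper line of the row of [m1] that misses [u]; columns are
   identified with its points. *)
have [x [fx rx nW _]] := pick_proper u
  (few_persp (foot_lev X l3) u0 (roof_lev X l3) uf3 u3 p2 up r3p qp uq fku).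
have [j1 _] := project (foot_lev X l3) u0 (roof_lev X l3) uf3 u3 (pt_lev X x) fx rx.
have [y0 _] := project_onto (foot_lev X l3) u0 (roof_lev X l3) uf3 u3 p2 up
  r3p (pt_lev X x) fx rx q1 qp uq.
have [y ey] := pt_onto y0 nW.
have [n [fn rn]] := line_through (foot_lev X l3) u0 (Wpt x) uf3 fx.
have yj : pt X y \sub u \cup pt X x by rewrite ey; lat.
have fy : foot X m1 \sub pt X y.
  by rewrite ey -fk; have := foot_roof X k => H; lat.
have [n2 [fn2 rn2]] := line_onto (foot_lev X m1) j1 fy yj.
have un : through u n by split; rewrite ?fn ?rn //; lat.
have un2 : through u n2 by split; rewrite ?fn2 ?rn2; [exact: um1.1 | lat].
have Sn : S n.
  have [->//|nn] := pselect (n = l1).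
  (* The rectangle with rows of [l1], [m1] and columns of [l1], [n]. *)
  have q2 : quad l1 n m1 n2.
    apply: (quad_intro u0 Wu) => //.
    - by rewrite fn.
    - by rewrite rn2.
    - by move=> e; apply: nn; apply/esym/(line_inj _ e); rewrite fn.
  by have [] := qS _ _ _ _ S1 Sm1 (quad_swap q2).
have [en|pn] := cS _ _ Sn S3 (costrong_foot fn).
  by rewrite -en.
have [] := pn; case; exists x.
by split; apply/(incE X); rewrite ?fn ?rn; split=> //; lat.
Qed.

End Quads.

Section Directions.
Variables (D : incidence_structure).
Implicit Types (x y a b c : ipoint D) (l m : iline D) (S : set (iline D)).

(** If [m] shares the column of [l] instead, a rectangle on [l] and [l'] yields
another line of [S] in that column through [u], and the dual of
[star_concurrent] applies. *)
Lemma step_star (X : chart D) S l l' m (u : el X) :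
  clique S -> quad_closed S -> S l -> S l' -> S m -> l <> l' ->
  foot X l = foot X l' -> foot X l = foot X m \/ roof X l = roof X m ->
  lev u = 0 -> horizon u -> through u l -> through u l' -> through u m.
Proof.
move=> cS qS Sl Sl' Sm n f [fm|rm] u0 Wu ul ul'.
  exact: (star_concurrent cS qS Sl Sl' Sm n f fm u0 Wu ul ul').
have nr : roof X l <> roof X l' by move=> /(line_inj f).
have [m1 [m2 [r1 r2 e [nf [um1 um2]]]]] := common_foot u0 Wu ul ul'.
have q := quad_intro u0 Wu f e r1 r2 nr nf ul ul' um1 um2.
have [Sm1 _] := qS _ _ _ _ Sl Sl' q.
apply/dual_through; apply: (@star_concurrent _ (dual X) S l m1 m u) => //.
- by move=> elm; apply: nf; rewrite elm.
- exact: dual_point.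
- exact/dual_through.
- exact/dual_through.
Qed.

Variable X : chart D.
Implicit Types (u v w z h d : el X).

Lemma step S l l' m u :
  clique S -> quad_closed S -> S l -> S l' -> S m -> l <> l' ->
  foot X l = foot X l' \/ roof X l = roof X l' ->
  foot X l = foot X m \/ roof X l = roof X m ->
  lev u = 0 -> horizon u -> through u l -> through u l' -> through u m.
Proof.
move=> cS qS Sl Sl' Sm n [f|r] o u0 Wu ul ul'; first exact: (step_star cS qS Sl Sl').
apply/dual_through; apply: (@step_star (dual X) S l l' m u) => //.
- by case: o; [right|left].
- exact: dual_point.
- exact/dual_through.
- exact/dual_through.
Qed.

Definition lines_at u : set (iline D) := fun l => through u l.

(** Rectangles stay in the bundle by [quad_concurrent], and [common_roof]
connects two lines in three steps. *)
Lemma direction_lines_at u l0 l1 : lev u = 0 -> horizon u ->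
  through u l0 -> through u l1 -> l0 <> l1 -> direction (lines_at u).
Proof.
move=> u0 Wu ul0 ul1 n; split; [|split; [|split]]; last by exists l0, l1.
- move=> l m ul um /(costrongE X) e.
  have [->|ne] := pselect (l = m); first by left.
  by right; apply: (par_intro ne e u0 Wu).
- move=> k1 k2 m1 m2 uk1 uk2 q; have [[/(parE X)[_ [[e|e] _]] _] _] := q.
    exact: (quad_concurrent q e u0 uk1 uk2).
  have [||] := (@quad_concurrent _ (dual X) _ _ _ _ u q e (dual_point u0)).
  + exact/dual_through.
  + exact/dual_through.
  by move=> /dual_through ? /dual_through.
- move=> l l' ul ul'.
  have [m [m' [fm fm' rm [_ [um um']]]]] := common_roof u0 Wu ul ul'.
  have parq_of k k' : through u k -> through u k' ->
      foot X k = foot X k' \/ roof X k = roof X k' -> parq k k'.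
    move=> uk uk' e; have [->|ne] := pselect (k = k'); first by left.
    by right; apply: (par_intro ne e u0 Wu).
  exists m, m'; split=> //; split; [|split]; apply: parq_of => //.
  + by left.
  + by right.
  + by left.
Qed.

(** The common point of one pair of parallel lines is carried along chains of
parallel lines by [step]. *)
Lemma direction_sub S : direction S ->
  exists u, [/\ lev u = 0, horizon u & forall l, S l -> through u l].
Proof.
move=> [cS [qS [kS [l0 [l1 [S0 [S1 n]]]]]]].
have [l [l' [Sl Sl' pl]]] : exists l l', [/\ S l, S l' & par l l'].
  have [m [m' [[Sm Sm'] [[e0|?] [[e1|?] [e2|?]]]]]] := kS _ _ S0 S1;
    do ?[by exists l0, m | by exists m, m' | by exists m', l1].
  by case: n; rewrite e0 e1.
have [nl [el [u [u0 Wu ul ul']]]] := iffLR (parE X _ _) pl.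
pose P k := through u k /\ exists k', [/\ S k', k <> k', through u k' &
  foot X k = foot X k' \/ roof X k = roof X k'].
have Pl : P l by split=> //; exists l'.
have Pm k m : P k -> S k -> S m -> parq k m -> P m.
  move=> [uk [k' [Sk' n' uk' e]]] Sk Sm [<-|/(parE X)[n2 [e2 _]]].
    by split=> //; exists k'.
  split; first exact: (step cS qS Sk Sk' Sm n' e e2 u0 Wu uk uk').
  by exists k; split=> //; [exact: nesym | case: e2; [left|right]].
exists u; split=> // k Sk; have [m [m' [[Sm Sm'] [e0 [e1 e2]]]]] := kS _ _ Sl Sk.
by have [] := Pm _ _ (Pm _ _ (Pm _ _ Pl Sl Sm e0) Sm Sm' e1) Sm' Sk e2.
Qed.

Lemma lines_at_inj u v l0 l1 : lev u = 0 -> lev v = 0 -> l0 <> l1 ->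
  through u l0 -> through u l1 -> through v l0 -> through v l1 -> u = v.
Proof.
move=> u0 v0 n u1 u2 v1 v2; apply: contrapT => nuv.
by apply: n; apply: (line_unique u0 v0 nuv).
Qed.

(** Distinct points then have distinct bundles. *)
Definition two_lines := forall u, lev u = 0 ->
  exists l l', [/\ l <> l', through u l & through u l'].

Hypothesis two : two_lines.

(** By [direction_sub] every direction is part of a bundle, and a bundle
contained in another one equals it. *)
Lemma improper_bundleE S : improper_bundle S <->
  exists u, [/\ lev u = 0, horizon u & S = lines_at u].
Proof.
split.
  move=> [dS mS]; have [u [u0 Wu Su]] := direction_sub dS.
  exists u; split=> //; apply/funext => l; apply/propext; split; first exact: Su.
  have [l0 [l1 [n ul0 ul1]]] := two u0.
  by apply: mS; first exact: direction_lines_at u0 Wu ul0 ul1 n.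
move=> [u [u0 Wu ->]]; have [l0 [l1 [n ul0 ul1]]] := two u0.
split; first exact: (direction_lines_at u0 Wu ul0 ul1 n).
move=> T dT sT l Tl; have [v [v0 Wv Tv]] := direction_sub dT.
rewrite (lines_at_inj u0 v0 n) //; [exact: Tv|exact/Tv/sT..].
Qed.

Lemma bundle_atE x S : bundle_at x S <-> S = lines_at (pt X x).
Proof.
split=> [bS|->]; last by move=> l; split=> /(incE X).
apply/funext => l; apply/propext; have [h1 h2] := bS l.
by split=> [/h1/(incE X)//|/(incE X)/h2].
Qed.

Lemma bundleE S : bundle S <-> exists2 u, lev u = 0 & S = lines_at u.
Proof.
split=> [[/improper_bundleE[u [u0 _ ->]]|[x /bundle_atE->]]|[u u0 ->]].
- by exists u.
- by exists (pt X x); first exact: pt_lev.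
- have [Wu|nW] := pselect (horizon u).
    by left; apply/improper_bundleE; exists u.
  by have [x ex] := pt_onto u0 nW; right; exists x; apply/bundle_atE; rewrite ex.
Qed.

Lemma bundle_inj u v : lev u = 0 -> lev v = 0 -> lines_at u = lines_at v -> u = v.
Proof.
move=> u0 v0 e; have [l0 [l1 [n ul0 ul1]]] := two u0.
have sub l : through u l -> through v l by rewrite -/(lines_at u l) e.
exact: (lines_at_inj u0 v0 n ul0 ul1 (sub _ ul0) (sub _ ul1)).
Qed.

Lemma proper_bundleE u : lev u = 0 -> proper_bundle (lines_at u) <-> ~ horizon u.
Proof.
move=> u0; split.
  by move=> [x /bundle_atE /(bundle_inj u0 (pt_lev X x))->]; exact: pt_proper.
by move=> /(pt_onto u0)[x <-]; exists x; apply/bundle_atE.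
Qed.

End Directions.

(** * Adjacency and collinearity *)

Section Adjacency.
Variables (D : incidence_structure) (X : chart D).
Implicit Types (u v w z h d : el X) (x y a b c : ipoint D) (l m : iline D).

(** Hypothesis (b) of the theorem for the strong subspaces that are contained in
stars, as expressed in the lattice. *)
Definition stars_reached := forall u h (d : el X),
  lev u = 0 -> lev h = - 1 -> lev d = 1 ->
  h \sub d -> h \sub u -> ~ u \sub d ->
  (exists x, h \sub pt X x) \/
  (exists v x, [/\ lev v = 0, h \sub v, v \sub d & pt X x \sub u \cup v]).

Lemma foot_below u : lev u = 0 -> exists h, h \sub u /\ lev h = - 1.
Proof.
move=> u0; have [|d [du d2]] := @below _ X u; first by lvl.
by have [||h [? ? ?]] := interpolate (i := - 1) du; try lvl; by exists h.
Qed.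

Lemma avoid_from h u p : lev h = - 1 -> lev u = 0 -> lev p = 2 -> h \sub u ->
  u \sub p -> exists d, [/\ lev d = 1, h \sub d, d \sub p & ~ u \sub d].
Proof.
move=> h1 u0 p2 hu up; have [d [hd dp e1 e2]] := relcompl hu up.
have := lev_mod u d; rewrite e1 e2 => e; exists d; split=> //; first lvl.
move=> ud; have := lev_meet (sub_self u) ud; rewrite e1; lvl.
Qed.

(** Apply [stars_reached] to a line that lies in a plane of a star through [u]
and misses [u]. *)
Lemma first_line u : stars_reached -> lev u = 0 -> horizon u ->
  exists l, through u l.
Proof.
move=> sr u0 Wu.
have Wpt x : u <> pt X x by move=> e; apply: (@pt_proper _ X x); rewrite -e.
have [h [hu h1]] := foot_below u0.
have [|p [up p2]] := @above _ X u; first by lvl.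
have [d [d1 hd dp ud]] := avoid_from h1 u0 p2 hu up.
have [[x hx]|[v [x [v0 hv vd xj]]]] := sr u h d u0 h1 d1 hd hu ud.
  have [l [fl rl]] := line_through h1 u0 (Wpt x) hu hx.
  by exists l; split; rewrite ?fl ?rl //; lat.
have uv : u <> v by move=> e; apply: ud; rewrite e.
have [_ j1] := star_span h1 u0 v0 uv hu hv.
have [_ m1] := top_span j1 u0 (pt_lev X x) (Wpt x) (jnl _ _) xj.
have [l [fl rl]] := line_onto m1 j1 (mtr u (pt X x)) xj.
by exists l; split; rewrite ?fl ?rl //; lat.
Qed.

Lemma two_linesP : stars_reached -> two_lines X.
Proof.
move=> sr u u0; have [Wu|/(pt_onto u0)[x ex]] := pselect (horizon u).
  have [l ul] := first_line sr u0 Wu.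
  have [m [_ [_ _ _ [n [um _]]]]] := common_roof u0 Wu ul ul.
  by exists m, l; split=> // e; apply: n; rewrite e.
have [h [hu h1]] := foot_below u0.
have [|p [up p2]] := @above _ X u; first by lvl.
have [||b [ub bp b1]] := interpolate (i := 1) up; try lvl.
have [b' [ub' bp' e1 e2]] := relcompl ub bp.
have b'1 : lev b' = 1 by have := lev_mod b b'; rewrite e1 e2; lvl.
have bb : b <> b'.
  move=> e; move: e1; rewrite -e => e1.
  by have := lev_meet (sub_self b) (sub_self b); rewrite e1; lvl.
rewrite -ex in hu ub ub' *.
have [l [fl rl]] := line_onto h1 b1 hu ub.
have [m [fm rm]] := line_onto h1 b'1 hu ub'.
exists l, m; split; [|by split; rewrite ?fl ?rl | by split; rewrite ?fm ?rm].
by move=> e; apply: bb; rewrite -rl -rm e.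
Qed.

(** A point of the star with foot [h] and a point of the top with roof [d] are
adjacent only if one of them lies on the line from [h] to [d]. *)
Lemma far h d u z : lev h = - 1 -> lev d = 1 -> lev u = 0 -> lev z = 0 ->
  h \sub d -> h \sub u -> ~ u \sub d -> z \sub d -> ~ h \sub z -> ~ adjq z u.
Proof.
move=> h1 d1 u0 z0 hd hu ud zd hz /(adjq_meet z0 u0) zu; apply: hz.
have du0 : lev (d \cap u) <= - 1.
  have := lev_le (mtr d u); have [e|] := pselect (lev (d \cap u) = 0); last by lvl.
  by case: ud; rewrite -(@lev_eq _ X _ u (mtr d u)) ?u0 //; lat.
have e1 : h = d \cap u by apply: le_lev_eq; [lat|lvl].
have <- : z \cap u = h by rewrite e1; apply: le_lev_eq; [lat|lvl].
lat.
Qed.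

Lemma joined_sound u v : joined (lines_at u) (lines_at v) -> adjq u v.
Proof. by move=> [l [ul vl]]; exact: adjq_on ul vl. Qed.

Hypothesis two : two_lines X.

Lemma reachE x u : lev u = 0 -> reach x (lines_at u) <-> adjq (pt X x) u.
Proof.
move=> u0; split=> [[l [/(incE X) xl ul]]|xu]; first exact: adjq_on xl ul.
have [e|n] := pselect (u = pt X x).
  have [l [_ [_ ul _]]] := two u0; exists l; split=> //.
  by apply/(incT X); rewrite -e.
have [m1 _] := adjq_span u0 (pt_lev X x) n (adjqC xu).
have [l [fl rl]] := line_through m1 u0 n (mtl _ _) (mtr _ _).
exists l; split; [apply/(incE X)|]; rewrite /lines_at /through ?fl ?rl.
  by split; lat.
by split; lat.
Qed.

Lemma joined_pt x u : lev u = 0 -> adjq (pt X x) u ->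
  joined (lines_at (pt X x)) (lines_at u).
Proof. by move=> u0 /(reachE x u0)[l [/(incE X) xl ul]]; exists l. Qed.

Lemma bundle_lines_at u : lev u = 0 -> bundle (lines_at u).
Proof. by move=> u0; apply/(bundleE two); exists u. Qed.

(** With [h] and [d] the foot and the roof of the line through the two auxiliary
points, each of [u], [v] and the proper point lies above [h] or below [d].  If
[u] and [v] were on different sides, the proper point would be on the side of
one of them, and so adjacent to it. *)
Lemma certified_sound R u v :
  (forall w z, lev w = 0 -> lev z = 0 -> R (lines_at w) (lines_at z) -> adjq w z) ->
  lev u = 0 -> lev v = 0 -> certified R (lines_at u) (lines_at v) -> adjq u v.
Proof.
move=> sound u0 v0 [V1 [V2 [a [[/(bundleE two)[w w0 ->] /(bundleE two)[z z0 ->]]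
  [n [Rwz [[Rwu Rwv] [[Rzu Rzv] [[/(reachE a w0) aw /(reachE a z0) az]
  [nu nv]]]]]]]]]].
have wz : w <> z by move=> e; apply: n; rewrite e.
have {}nu : ~ adjq (pt X a) u by move=> /(reachE a u0).
have {}nv : ~ adjq (pt X a) v by move=> /(reachE a v0).
have swz := sound _ _ w0 z0 Rwz.
have [m1 j1] := adjq_span w0 z0 wz swz.
have side t : lev t = 0 -> R (lines_at w) (lines_at t) ->
    R (lines_at z) (lines_at t) -> w \cap z \sub t \/ t \sub w \cup z.
  move=> t0 Rwt Rzt; apply: (tri w0 z0 t0 wz swz); apply: adjqC.
    exact: sound Rwt.
  exact: sound Rzt.
have a0 := pt_lev X a.
have sa := tri w0 z0 a0 wz swz aw az.
have st p q : lev p = 0 -> lev q = 0 -> w \cap z \sub p -> w \cap z \sub q ->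
  adjq p q by exact: adjq_star.
have tp p q : p \sub w \cup z -> q \sub w \cup z -> adjq p q by exact: adjq_top.
have [su|tu] := side u u0 Rwu Rzu; have [sv|tv] := side v v0 Rwv Rzv.
- exact: st.
- by case: sa => [sa|ta]; [case: nu; exact: st | case: nv; exact: tp].
- by case: sa => [sa|ta]; [case: nv; exact: st | case: nu; exact: tp].
- exact: tp.
Qed.

Lemma adj1_sound u v : lev u = 0 -> lev v = 0 ->
  adj1 (lines_at u) (lines_at v) -> adjq u v.
Proof.
move=> u0 v0 [/joined_sound//|]; apply: certified_sound => // w z _ _.
exact: joined_sound.
Qed.

Lemma adj2_sound u v : lev u = 0 -> lev v = 0 ->
  adj2 (lines_at u) (lines_at v) -> adjq u v.
Proof.
move=> u0 v0 [/adj1_sound->//|]; apply: certified_sound => // w z.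
exact: adj1_sound.
Qed.

(** Take the auxiliary points on a proper line [m] of the star that misses [u]
and [v]; its top contains a proper point outside the star, and [far] separates
this point from [u] and [v]. *)
Lemma adj1_star u v x : lev u = 0 -> lev v = 0 -> u <> v -> adjq u v ->
  u \cap v \sub pt X x -> adj1 (lines_at u) (lines_at v).
Proof.
move=> u0 v0 n uv hx.
have [h1 j1] := adjq_span u0 v0 n uv.
set h := u \cap v in h1 hx *; set d := u \cup v in j1.
have hu : h \sub u by rewrite /h; lat.
have hv : h \sub v by rewrite /h; lat.
have ud : u \sub d by rewrite /d; lat.
have vd : v \sub d by rewrite /d; lat.
have hd : h \sub d by lat.
have [xd|xd] := pselect (pt X x \sub d).
  have [l [fl rl]] := line_onto h1 j1 hx xd.
  by left; exists l; rewrite /lines_at /through fl rl.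
right; have [w [w0 hw wd [wu wv]]] := third_point u v h1 j1 hd.
have wx : w <> pt X x by move=> e; apply: xd; rewrite -e.
have [m [fm rm]] := line_through h1 w0 wx hw hx.
set q := w \cup pt X x in rm; have q1 : lev q = 1 by rewrite -rm roof_lev.
have wq : w \sub q by rewrite /q; lat.
have xq : pt X x \sub q by rewrite /q; lat.
have off t : lev t = 0 -> w <> t -> t \sub d -> ~ t \sub q.
  move=> t0 nt td tq; apply: xd.
  have [e1 _] := top_span j1 w0 t0 nt wd td.
  by have [e2 _] := top_span q1 w0 t0 nt wq tq; rewrite -e1 e2.
have [y [ym yx _]] := proper_on m (pt X x) (pt X x).
have [hy yq] : h \sub pt X y /\ pt X y \sub q by case: ym; rewrite fm rm.
have [|g [gh g2]] := @below _ X h; first by lvl.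
(* A foot [k] of [x] other than [h] leads out of the star, inside the top of
   [m]. *)
have [k [gk kx e1 e2]] := relcompl gh hx.
have k1 : lev k = - 1 by have := lev_mod h k; rewrite e1 e2 pt_lev; lvl.
have [l [fl rl]] := line_onto k1 q1 kx xq.
have [a [[ka aq] ax _]] := proper_on l (pt X x) (pt X x).
rewrite fl in ka; rewrite rl in aq.
have nha : ~ h \sub pt X a.
  move=> ha; apply: ax; apply/esym/le_lev_eq; last by rewrite !pt_lev.
  by rewrite -e2; lat.
have L := pt_lev X.
have hq : h \sub q by lat.
have nr t : lev t = 0 -> w <> t -> t \sub d -> h \sub t -> ~ reach a (lines_at t).
  move=> t0 nt td ht /(reachE a t0).
  exact: (far h1 q1 t0 (L a) hq ht (off _ t0 nt td) aq nha).
exists (lines_at (pt X x)), (lines_at (pt X y)), a.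
split; first by split; apply: bundle_lines_at.
split; first by move=> /(bundle_inj two (L x) (L y)); exact/nesym.
have J c t : lev t = 0 -> h \sub pt X c -> h \sub t ->
    joined (lines_at (pt X c)) (lines_at t).
  by move=> t0 hz ht; apply: joined_pt => //; exact: adjq_star h1 _ _ hz ht.
split; first exact: J.
split; first by split; exact: J.
split; first by split; exact: J.
split; first by split; apply/reachE => //; exact: adjq_top q1 _ _.
by split; apply: nr.
Qed.

End Adjacency.

Section Completeness.
Variables (D : incidence_structure) (X : chart D).
Implicit Types (u v w z h d : el X) (x y a b c : ipoint D) (l m : iline D).

Lemma dual_lines_at u : @lines_at _ (dual X) u = lines_at u.
Proof. by apply/funext => l; apply/propext; exact: dual_through. Qed.

Lemma dual_two_lines : two_lines X -> two_lines (dual X).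
Proof.
move=> two u u0; have [|l [l' [n ul ul']]] := two u; first by move: u0 => /=; lia.
by exists l, l'; split=> //; exact/dual_through.
Qed.

Hypotheses (two : two_lines X) (sr : stars_reached X).

Lemma adj1_top u v x : lev u = 0 -> lev v = 0 -> u <> v -> adjq u v ->
  pt X x \sub u \cup v -> adj1 (lines_at u) (lines_at v).
Proof.
move=> u0 v0 n uv xj; rewrite -!dual_lines_at.
apply: (@adj1_star _ (dual X) (dual_two_lines two) u v x) => //.
- exact: dual_point.
- exact: dual_point.
- by move: uv; rewrite adjq_meet // /adjq /=; lia.
Qed.

Lemma few_sub h d (P Q : el X -> Prop) :
  (forall u, lev u = 0 -> h \sub u -> u \sub d -> P u -> Q u) ->
  few h d Q -> few h d P.
Proof.
move=> PQ fQ s us ins; apply: fQ => // u /ins[u0 hu ud Pu].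
by split=> //; exact: PQ.
Qed.

Definition inactive u v := ~ exists x, pt X x \sub u \cup v.

(** Since the star at [h] is improper, [stars_reached] gives one top through [u]
with a proper point [x], so that [u \cap x] is the foot of a proper line through
[u].  In the grid at [u] an inactive column is improper in the row of this foot,
and in a plane that row has at most [ind X] improper columns. *)
Lemma few_inactive h p u d : lev h = - 1 -> lev p = 2 -> lev u = 0 ->
  lev d = 1 -> h \sub u -> u \sub p -> h \sub d -> d \sub p -> ~ u \sub d ->
  (forall x, ~ h \sub pt X x) -> few h d (inactive u).
Proof.
move=> h1 p2 u0 d1 hu up hd dp ud Wh.
have Wpt x : u <> pt X x by move=> e; apply: (Wh x); rewrite -e.
have [[x /Wh//]|[v [x [v0 hv vd xj]]]] := sr u0 h1 d1 hd hu ud.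
have [j1 _] := project h1 u0 d1 hu ud v0 hv vd.
have xp : pt X x \sub p by have vp := sub_tr vd dp; lat.
have [_ m1] := top_span j1 u0 (pt_lev X x) (Wpt x) (jnl _ _) xj.
have [q [q1 xq qp uq]] :=
  avoid m1 u0 p2 (pt_lev X x) (Wpt x) (mtl _ _) (mtr _ _) up xp.
have [l [fl rl]] := line_onto m1 q1 (mtr _ _) xq.
rewrite -rl in q1 qp uq.
have fu : foot X l \sub u by rewrite fl; lat.
apply: few_sub (few_persp h1 u0 d1 hu ud p2 up dp qp uq fu) => z z0 hz zd nz.
apply: contrapT => nW; apply: nz.
have [y0 _] := project_onto h1 u0 d1 hu ud p2 up dp z0 hz zd q1 qp uq.
by have [y ey] := pt_onto y0 nW; exists y; rewrite ey; lat.
Qed.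

(** If the star of [u] and [v] has no proper point, choose in a plane of it a
line [m] with active top that misses [u] and [v].  By [few_inactive] two points
[s] and [t] of [m] are joined to both [u] and [v] by lines with active tops, and
a proper point below [m] is far from [u] and [v]. *)
Lemma adj2_complete u v : lev u = 0 -> lev v = 0 -> adjq u v ->
  adj2 (lines_at u) (lines_at v).
Proof.
move=> u0 v0 uv; have [<-|n] := pselect (u = v).
  by have [l [_ [_ ul _]]] := two u0; left; left; exists l.
have [h1 j1] := adjq_span u0 v0 n uv.
have [[x hx]|Wh] := pselect (exists x, u \cap v \sub pt X x).
  left; exact: adj1_star hx.
have {}Wh x : ~ u \cap v \sub pt X x by move=> hx; apply: Wh; exists x.
set h := u \cap v in h1 Wh; set d := u \cup v in j1.
have hu : h \sub u by rewrite /h; lat.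
have hv : h \sub v by rewrite /h; lat.
have ud : u \sub d by rewrite /d; lat.
have vd : v \sub d by rewrite /d; lat.
have hd : h \sub d by lat.
have [|p [dp p2]] := @above _ X d; first by lvl.
have [w [w0 hw wd [wu wv]]] := third_point u v h1 j1 hd.
have wp := sub_tr wd dp.
have [e [e1 he ep we]] := avoid_from h1 w0 p2 hw wp.
have [z [z0 hz ze [/contrapT[x xm] _ nz]]] := pick (d \cap e) h1 e1 he
  (few_inactive h1 p2 w0 e1 hw wp he ep we Wh) (few_none X h e).
have [m1 _] := project h1 w0 e1 hw we z0 hz ze.
set m := w \cup z in xm m1.
have wm : w \sub m by rewrite /m; lat.
have zm : z \sub m by rewrite /m; lat.
have hm : h \sub m by lat.
have mp : m \sub p by have zp := sub_tr ze ep; rewrite /m; lat.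
have off t : lev t = 0 -> w <> t -> t \sub d -> ~ t \sub m.
  move=> t0 nt td tm; apply: nz.
  have [q1 _] := top_span j1 w0 t0 nt wd td.
  have [q2 _] := top_span m1 w0 t0 nt wm tm.
  have zd : z \sub d by rewrite -q1 q2.
  apply: le_lev_eq; first lat.
  rewrite z0; have de : d <> e by move=> de; apply: we; rewrite -de.
  by have := @lev_meet_lt _ X d e; rewrite j1 e1 => /(_ erefl de); lvl.
have um := off _ u0 wu ud; have vm := off _ v0 wv vd.
have fu := few_inactive h1 p2 u0 m1 hu (sub_tr ud dp) hm mp um Wh.
have fv := few_inactive h1 p2 v0 m1 hv (sub_tr vd dp) hm mp vm Wh.
have [s [s0 hs sm [/contrapT[a1 ua1] /contrapT[b1 vb1] _]]] :=
  pick u h1 m1 hm fu fv.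
have [t [t0 ht tm [/contrapT[a2 ua2] /contrapT[b2 vb2] nst]]] :=
  pick s h1 m1 hm fu fv.
have A q r c : lev q = 0 -> lev r = 0 -> h \sub q -> h \sub r -> q <> r ->
    pt X c \sub r \cup q -> adj1 (lines_at q) (lines_at r).
  move=> q0 r0 hq hr nqr cj; apply: (@adj1_top _ _ c) => //.
    exact: adjq_star h1 q0 r0 hq hr.
  by rewrite jnC.
have [est _] := top_span m1 t0 s0 nst tm sm.
have su : s <> u by move=> E; apply: um; rewrite -E.
have sv : s <> v by move=> E; apply: vm; rewrite -E.
have tu : t <> u by move=> E; apply: um; rewrite -E.
have tv : t <> v by move=> E; apply: vm; rewrite -E.
right; exists (lines_at s), (lines_at t), x.
split; first by split; apply: bundle_lines_at.
split; first by move=> /(bundle_inj two s0 t0)/esym.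
split; first by apply: (A s t x) => //; [exact: nesym | rewrite est].
split; first by split; [exact: (A s u a1) | exact: (A s v b1)].
split; first by split; [exact: (A t u a2) | exact: (A t v b2)].
split; first by split; apply/reachE => //; exact: adjq_top m1 _ _.
split; move=> /reachE.
  move=> /(_ two u0); exact: (far h1 m1 u0 (pt_lev X x) hm hu um xm (Wh x)).
move=> /(_ two v0); exact: (far h1 m1 v0 (pt_lev X x) hm hv vm xm (Wh x)).
Qed.

Lemma adj2E u v : lev u = 0 -> lev v = 0 ->
  adj2 (lines_at u) (lines_at v) <-> adjq u v.
Proof. by move=> u0 v0; split; [exact: adj2_sound | exact: adj2_complete]. Qed.

End Completeness.

Section Third.
Variables (D : incidence_structure).

(** Otherwise a complement [z] of the foot in the top of [u] and [v] is adjacent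
to both, but not to [w]. *)
Lemma third_star (X : chart D) (u v w : el X) : lev u = 0 -> lev v = 0 ->
  lev w = 0 -> u <> v -> adjq u v -> u \cap v \sub w ->
  (forall z : el X, lev z = 0 -> adjq z u -> adjq z v -> adjq z w) ->
  w \sub u \cup v.
Proof.
move=> u0 v0 w0 n uv hw all; apply: contrapT => wd.
have [h1 j1] := adjq_span u0 v0 n uv.
have hd : u \cap v \sub u \cup v by lat.
have [|g [gh g2]] := @below _ X (u \cap v); first by lvl.
have [z [gz zd e1 e2]] := relcompl gh hd.
have z0 : lev z = 0 by have := lev_mod (u \cap v) z; rewrite e1 e2; lvl.
have hz : ~ u \cap v \sub z.
  by move=> /(lev_meet (sub_self _)); rewrite e1; lvl.
apply: (far h1 j1 w0 z0 hd hw wd zd hz); apply: all => //.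
  exact: adjq_top j1 zd (jnl _ _).
exact: adjq_top j1 zd (jnr _ _).
Qed.

Variable X : chart D.
Implicit Types (u v w z : el X).
Hypotheses (two : two_lines X) (sr : stars_reached X).

Lemma thirdE u v w : lev u = 0 -> lev v = 0 -> lev w = 0 -> u <> v ->
  adjq u v ->
  third (lines_at u) (lines_at v) (lines_at w) <->
  u \cap v \sub w /\ w \sub u \cup v.
Proof.
move=> u0 v0 w0 n uv.
have [h1 j1] := adjq_span u0 v0 n uv.
split.
  move=> th.
  have all z : lev z = 0 -> adjq z u -> adjq z v -> adjq z w.
    move=> z0 zu zv; apply/(adj2E two sr z0 w0).
    apply: th; [exact: bundle_lines_at | exact/adj2E..].
  have wu : adjq w u.
    by apply/adjqC/all => //; exact: adjq_top j1 (jnl _ _) (jnl _ _).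
  have wv : adjq w v.
    apply/adjqC/all => //; first exact: adjqC.
    exact: adjq_top j1 (jnr _ _) (jnr _ _).
  have dual_adjq z (t : el X) : lev z = 0 -> lev t = 0 ->
      @adjq _ (dual X) z t <-> adjq z t.
    by move=> z0 t0; rewrite (adjq_meet z0 t0) /adjq /=; split; lia.
  have [hw|wd] := tri u0 v0 w0 n uv wu wv; split=> //.
    exact: third_star hw all.
  apply: (@third_star (dual X) u v w) => //; try exact: dual_point.
    exact/dual_adjq.
  move=> z z0; have {}z0 : @lev _ X z = 0 by move: z0 => /=; lia.
  by move=> /(dual_adjq _ _ z0 u0) zu /(dual_adjq _ _ z0 v0) zv; apply/dual_adjq/all.
move=> [hw wd] Z /(bundleE two)[z z0 ->].
rewrite !adj2E // => zu zv.
have [hz|zd] := tri u0 v0 z0 n uv zu zv.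
  exact: adjq_star h1 z0 w0 hz hw.
exact: adjq_top j1 zd wd.
Qed.

End Third.

(** * The chart of a Grassmann space *)

Section Cardinality.
Local Close Scope ring_scope.
Variable T : eqType.
Lemma size_le_card (A : set T) n (s : seq T) : (A #<= `I_n)%card ->
  uniq s -> (forall x, x \in s -> A x) -> size s <= n.
Proof.
move=> /pcard_leP/injfunPex[g gn gi] us sA.
rewrite -(size_map g) -(size_iota 0 n); apply: uniq_leq_size.
  rewrite map_inj_in_uniq // => x y xs ys e.
  by apply: gi => //; rewrite inE; exact: sA.
by move=> _ /mapP[x xs ->]; rewrite mem_iota; exact/gn/sA.
Qed.

Lemma seq_of_card (A : set T) n : (`I_n #<= A)%card ->
  exists s : seq T, [/\ uniq s, size s = n & forall x, x \in s -> A x].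
Proof.
move=> /card_leP[f].
pose p (i : 'I_n) : set_type `I_n := SigSub (mem_set (ltn_ord i : `I_n i)).
exists [seq val (f (p i)) | i <- enum 'I_n]; split.
- rewrite map_inj_uniq ?enum_uniq // => i j /val_inj /(@inj _ _ _ f).
  by move=> /(_ (mem_set I) (mem_set I)) /(congr1 val) /= /ord_inj.
- by rewrite size_map size_enum_ord.
- by move=> _ /mapP[i _ ->]; exact: set_valP.
Qed.
End Cardinality.

Section Subspaces.
Variables (F : fieldType) (V : vectType F).
Implicit Types U W Z : {vspace V}.

Lemma vspace_of_dim U W m : (U <= W)%VS -> (\dim U <= m <= \dim W)%N ->
  exists Z, [/\ (U <= Z)%VS, (Z <= W)%VS & \dim Z = m].
Proof.
move=> UW /andP[Um mW]; set C := (W :\: U)%VS.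
have dC : (\dim C = \dim W - \dim U)%N.
  by have := dimv_cap_compl W U; rewrite (capv_idPr UW) -/C; lia.
set X := take (m - \dim U) (vbasis C).
have XC : (<<X>> <= C)%VS.
  by apply/span_subvP => v /mem_take /vbasis_mem.
have fX : free X.
  have := basis_free (vbasisP C); rewrite -(cat_take_drop (m - \dim U) (vbasis C)).
  by rewrite cat_free => /and3P[].
have dX : (\dim <<X>> = m - \dim U)%N.
  by move: fX; rewrite /free => /eqP ->; rewrite size_takel // size_tuple dC; lia.
exists (U + <<X>>)%VS; split.
- exact: addvSl.
- by rewrite subv_add UW (subv_trans XC) // diffvSl.
- rewrite dimv_disjoint_sum ?dX; first by lia.
  apply/eqP; rewrite -subv0 -(capv_diff W U) capvC; exact: capvS.
Qed.

Lemma vspace_relcompl U W Z : (U <= W)%VS -> (W <= Z)%VS ->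
  exists W', [/\ (U <= W')%VS, (W' <= Z)%VS, (W :&: W')%VS = U &
    (W + W')%VS = Z].
Proof.
move=> UW WZ; exists (U + (Z :\: W))%VS; split.
- exact: addvSl.
- by rewrite subv_add (subv_trans UW WZ) diffvSl.
- by rewrite capvC -vspace_modl // capv_diff addv0.
- by rewrite addvA (addv_idPl UW) addvC addv_diff (addv_idPl WZ).
Qed.

End Subspaces.

Lemma sval_inj (T : Type) (P : T -> Prop) : injective (@sval T P).
Proof.
by move=> [a Pa] [b Pb] /= e; subst b; congr exist; exact: Prop_irrelevance.
Qed.

Section Pencils.
Variables (F : fieldType) (V : vectType F) (k : nat).

Lemma line_of_coordinates H B : (\dim H).+1 = k -> \dim B = k.+1 ->
  (H <= B)%VS -> lines (p := grassmann_space V k)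
    [set U : Defs.Sub V k | (H <= val U)%VS /\ (val U <= B)%VS].
Proof.
move=> dH dB HB; have eH : \dim H == k.-1 by apply/eqP; lia.
have eB : \dim B == k.+1 by apply/eqP.
by exists (exist _ H eH), (exist _ B eB).
Qed.

Lemma two_between H B : (\dim H).+1 = k -> \dim B = k.+1 -> (H <= B)%VS ->
  exists U1 U2 : Defs.Sub V k, [/\ (val U1 :&: val U2)%VS = H,
    (val U1 + val U2)%VS = B, (val U1 <= B)%VS & (val U2 <= B)%VS].
Proof.
move=> dH dB HB; have [|U [HU UB dU]] := vspace_of_dim (m := k) HB; first lia.
have [U' [HU' UB' e1 e2]] := vspace_relcompl HU UB.
have dU' : \dim U' = k by have := dimv_sum_cap U U'; rewrite e1 e2; lia.
move/eqP in dU; move/eqP in dU'.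
by exists (exist _ U dU), (exist _ U' dU').
Qed.

(** Two points of a line determine its foot as their intersection and its roof
as their sum. *)
Lemma coordinates_unique H B H' B' : (\dim H).+1 = k -> \dim B = k.+1 ->
  (H <= B)%VS -> (\dim H').+1 = k -> \dim B' = k.+1 ->
  [set U : Defs.Sub V k | (H <= val U)%VS /\ (val U <= B)%VS] `<=`
  [set U : Defs.Sub V k | (H' <= val U)%VS /\ (val U <= B')%VS] ->
  H = H' /\ B = B'.
Proof.
move=> dH dB HB dH' dB' sub.
have [U1 [U2 [e1 e2 B1 B2]]] := two_between dH dB HB.
have [|a1 a2] := sub U1; first by rewrite /= -e1 capvSl.
have [|b1 b2] := sub U2; first by rewrite /= -e1 capvSr.
split; apply/eqP.
  by rewrite eq_sym eqEdim -{1}e1 subv_cap a1 b1; lia.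
by rewrite eqEdim -{1}e2 subv_add a2 b2; lia.
Qed.

Hypothesis k_gt0 : (0 < k)%N.
Variable W : set (points (grassmann_space V k)).

Lemma line_coordinates (p : iline (complement W)) :
  exists HB : {vspace V} * {vspace V},
  [/\ (\dim HB.1).+1 = k, \dim HB.2 = k.+1, (HB.1 <= HB.2)%VS &
    sval p = [set U | (HB.1 <= val U)%VS /\ (val U <= HB.2)%VS]].
Proof.
case: p => p [[H [B [HB ep]]] np] /=; exists (val H, val B) => /=; split=> //.
  by rewrite (eqP (valP H)); lia.
exact: (eqP (valP B)).
Qed.

Definition coordinates p := sval (cid (line_coordinates p)).

End Pencils.

Section GrassmannChart.
Variables (F : fieldType) (V : vectType F) (k lambda : nat).
Variable W : set (points (grassmann_space V k)).
Hypotheses (k_gt1 : (1 < k)%N) (k_lt : (k + 2 <= \dim {: V})%N)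
  (lambda_gt0 : (0 < lambda)%N)
  (few_improper : forall p, lines p ->
     (p `&` W #<= `I_lambda)%card \/ p `<=` W)
  (big_lines : forall p : set (points (grassmann_space V k)), lines p ->
     (`I_(2 * lambda + 2)%N #<= p)%card).
Let k_gt0 : (0 < k)%N := ltnW k_gt1.
Local Notation D := (complement W).
Local Notation coordinates := (coordinates k_gt0).
Implicit Types (U A B : {vspace V}) (p : iline D) (x : ipoint D).

Definition grassmann_horizon U := exists2 S : Defs.Sub V k, val S = U & W S.

Definition grassmann_level U : int := (\dim U)%:Z - k%:Z.

Definition grassmann_chart : chart D.
Proof.
refine (@Chart D {vspace V} (fun U U' => (U <= U')%VS) (fun U U' => (U :&: U')%VS)
  (fun U U' => (U + U')%VS) grassmann_level _ _ _ _ _ _ _ _ _ _ _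
  grassmann_horizon lambda lambda_gt0 (fun x => val (sval x))
  (fun p => (coordinates p).1) (fun p => (coordinates p).2)
  _ _ _ _ _ _ _ _ _ _ _ _ _); rewrite /grassmann_level.
- exact: subvv.
- exact: subv_trans.
- by move=> U U' A; rewrite subv_cap.
- by move=> U U' A; rewrite subv_add.
- by move=> U U' /dimvS; lia.
- by move=> U U' UU' e; apply/eqP; rewrite eqEdim UU'; lia.
- by move=> U U'; have := dimv_sum_cap U U'; lia.
- move=> U U' i UU' l1 l2.
  have [|Z [? ? dZ]] := vspace_of_dim (m := absz (i + k%:Z)%R) UU'; first lia.
  by exists Z; split=> //; lia.
- by move=> U A U' UA AU'; exact: vspace_relcompl.
- move=> U U2; have [|Z [_ ? dZ]] := vspace_of_dim (m := (k - 2)%N) (sub0v U).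
    by rewrite dimv0; lia.
  by exists Z; split=> //; lia.
- move=> U U2; have [|Z [? _ dZ]] := vspace_of_dim (m := (k + 2)%N) (subvf U).
    by lia.
  by exists Z; split=> //; lia.
- by move=> x; rewrite (eqP (valP (sval x))) subrr.
- by move=> x [S /val_inj -> WS]; exact: (svalP x).
- by move=> x y /val_inj/sval_inj.
- move=> U U0 nU; have dU : \dim U == k by apply/eqP; lia.
  have nW : ~ W (exist _ U dU) by move=> WU; apply: nU; exists (exist _ U dU).
  by exists (exist _ (exist _ U dU) nW).
- by move=> p; rewrite /coordinates; case: cid => /= -[H B] [/= ? _ _ _]; lia.
- by move=> p; rewrite /coordinates; case: cid => /= -[H B] [/= _ ? _ _]; lia.
- by move=> p; rewrite /coordinates; case: cid => /= -[H B] [].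
- move=> p q; rewrite /coordinates; case: cid => /= -[H B] [/= _ _ _ ep].
  case: cid => /= -[H' B'] [/= _ _ _ eq] eH eB.
  by apply: sval_inj; rewrite ep eq eH eB.
- move=> H B x H1 B1 Hx xB.
  have dH : (\dim H).+1 = k by lia.
  have dB : \dim B = k.+1 by lia.
  have nW : ~ [set U : Defs.Sub V k | (H <= val U)%VS /\ (val U <= B)%VS] `<=` W.
    by move=> /(_ (sval x)) sub; apply: (svalP x); apply: sub.
  pose proper (q : set (points (grassmann_space V k))) :=
    lines q /\ ~ q `<=` W.
  exists (exist proper _
            (conj (line_of_coordinates dH dB (subv_trans Hx xB)) nW)).
  rewrite /coordinates; case: cid => /= -[H' B'] [/= dH' dB' HB' e].
  have [|-> ->//] := coordinates_unique dH dB (subv_trans Hx xB) dH' dB'.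
  by rewrite e.
- move=> p; have [U pU nWU] : exists2 U, sval p U & ~ W U.
    case: p => p [/= _ nW]; apply: contrapT => none; apply: nW => U pU.
    by apply: contrapT => nWU; apply: none; exists U.
  by exists (exist _ U nWU).
- by move=> x p; rewrite /coordinates; case: cid => /= -[H B] [/= _ _ _ ->].
- move=> p s us; rewrite /coordinates; case: cid => /= -[H B] [/= _ _ _ e] ins.
  have [t et] : exists t : seq (Defs.Sub V k), map val t = s.
    elim: s ins {us} => [|U s IHs] ins; first by exists [::].
    have [|t et] := IHs; first by move=> U' U's; apply: ins; rewrite inE U's orbT.
    have [_ _ _ [S SU _]] := ins U (mem_head _ _).
    by exists (S :: t); rewrite /= et SU.
  rewrite -et in us ins *; rewrite size_map.
  have [lp np] := svalP p; have [few|//] := few_improper lp.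
  apply: size_le_card few (map_uniq us) _ => U Ut.
  have [_ HU UB [S /val_inj eS WS]] := ins _ (map_f val Ut).
  by split; rewrite ?e // -eS.
- move=> H B H1 B1 HB.
  have dH : (\dim H).+1 = k by lia.
  have dB : \dim B = k.+1 by lia.
  have [s [us ss ins]] := seq_of_card (big_lines (line_of_coordinates dH dB HB)).
  exists (map val s); split.
  + by rewrite map_inj_uniq //; exact: val_inj.
  + by rewrite size_map ss.
  + move=> _ /mapP[U /ins[HU UB] ->]; split=> //.
    by rewrite (eqP (valP U)) subrr.
Defined.

End GrassmannChart.

(** * Recovery *)

Section Recovery.
Variables (F : fieldType) (V : vectType F) (k lambda : nat).
Variable W : set (points (grassmann_space V k)).
Hypotheses (k_gt1 : (1 < k)%N) (k_lt : (k + 2 <= \dim {: V})%N)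
  (lambda_gt0 : (0 < lambda)%N)
  (few_improper : forall p, lines p ->
     (p `&` W #<= `I_lambda)%card \/ p `<=` W)
  (big_lines : forall p : set (points (grassmann_space V k)), lines p ->
     (`I_(2 * lambda + 2)%N #<= p)%card).
Local Notation D := (complement W).
Local Notation X :=
  (grassmann_chart k_gt1 k_lt lambda_gt0 few_improper big_lines).

(** Points seen as lattice elements; a constant rather than a coercion keeps
[el] of the chart from being unfolded. *)
Definition emb (U : Defs.Sub V k) : el X := val U.

Lemma emb_inj : injective emb.
Proof. exact: val_inj. Qed.

Lemma level0 (U : Defs.Sub V k) : lev (emb U) = 0.
Proof. by rewrite /= /grassmann_level (eqP (valP U)) subrr. Qed.

Lemma levelE (H : {vspace V}) (i : int) : @lev _ X H = i <-> (\dim H)%:Z = k%:Z + i.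
Proof. by rewrite /= /grassmann_level; split; lia. Qed.

Lemma line_between (q : set (points (grassmann_space V k))) : lines q ->
  exists H B : el X, [/\ lev H = - 1, lev B = 1, H \sub B &
    q = [set U : Defs.Sub V k | H \sub emb U /\ emb U \sub B]].
Proof.
move=> [H [B [HB ->]]]; exists (val H), (val B); split=> //.
  by apply/levelE; rewrite (eqP (valP H)); lia.
by apply/levelE; rewrite (eqP (valP B)); lia.
Qed.

Lemma lineP (H B : el X) : lev H = - 1 -> lev B = 1 -> H \sub B ->
  lines (p := grassmann_space V k)
    [set U : Defs.Sub V k | H \sub emb U /\ emb U \sub B].
Proof.
by move=> /levelE dH /levelE dB HB; apply: line_of_coordinates HB; lia.
Qed.

Lemma star_subspace (H : el X) : lev H = - 1 ->
  subspace (M := grassmann_space V k) [set U | H \sub emb U].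
Proof.
move=> H1 q U1 U2 /line_between[H' [B' [H'1 B'1 HB' ->]]] n [h1 _] [h2 _].
move=> u1 u2 U [hU _].
have nv : emb U1 <> emb U2 by move=> /emb_inj.
have [e1 _] := star_span H1 (level0 U1) (level0 U2) nv u1 u2.
have [e2 _] := star_span H'1 (level0 U1) (level0 U2) nv h1 h2.
by rewrite /= -e1 e2.
Qed.

Lemma collinear_adjq (U1 U2 : Defs.Sub V k) :
  collinear (M := grassmann_space V k) U1 U2 -> adjq (emb U1) (emb U2).
Proof.
move=> [q [/line_between[H [B [_ B1 _ ->]]] [_ u1] [_ u2]]].
exact: adjq_top B1 u1 u2.
Qed.

Lemma star_collinear (H : el X) (U1 U2 : Defs.Sub V k) : lev H = - 1 -> U1 <> U2 ->
  H \sub emb U1 -> H \sub emb U2 -> collinear (M := grassmann_space V k) U1 U2.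
Proof.
move=> H1 n h1 h2; have nv : emb U1 <> emb U2 by move=> /emb_inj.
have [_ j1] := star_span H1 (level0 U1) (level0 U2) nv h1 h2.
have hj : H \sub (emb U1 \cup emb U2) by lat.
exists [set U : Defs.Sub V k | H \sub emb U /\ emb U \sub (emb U1 \cup emb U2)].
by split; [exact: lineP | split=> //; lat..].
Qed.

(** The star is a subspace with any two points collinear, so it contains the
span of [A]. *)
Lemma span_star_strong (H : el X) (A : set (points (grassmann_space V k))) :
  lev H = - 1 -> (forall U : Defs.Sub V k, A U -> H \sub emb U) ->
  strong (span_subspace A).
Proof.
move=> H1 AH; have inH U : span_subspace A U -> H \sub emb U.
  by move=> /(_ _ (conj (star_subspace H1) AH)).
split; last by move=> U1 U2 n /inH u1 /inH u2; exact: star_collinear H1 n u1 u2.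
move=> q U1 U2 lq n q1 q2 s1 s2 U qU Y [sY AY].
exact: (sY q U1 U2 lq n q1 q2 (s1 _ (conj sY AY)) (s2 _ (conj sY AY)) U qU).
Qed.

Hypothesis reached : forall (U : points (grassmann_space V k)) p,
  lines p -> ~ p U -> strong (span_subspace ([set U] `|` p)) ->
  exists Y, [/\ maximal_strong Y, ~ Y `<=` W, Y U & Y `&` p !=set0].

Lemma point_of (u : el X) : lev u = 0 -> exists U : Defs.Sub V k, emb U = u.
Proof.
move=> /levelE du; have dU : \dim u == k by apply/eqP; lia.
by exists (exist _ u dU).
Qed.

(** The maximal strong subspace given by (b) has a proper point, which is
collinear with [U] and with a point [A] of the line; by [tri] it belongs to the
star at [h] or to the top of [U] and [A]. *)
Lemma grassmann_stars_reached : stars_reached X.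
Proof.
move=> _ h d /point_of[U <-] h1 d1 hd hU Ud.
set p := [set S : Defs.Sub V k | h \sub emb S /\ emb S \sub d].
have lp : lines (p := grassmann_space V k) p by exact: lineP.
have npU : ~ p U by case.
have st : strong (span_subspace (M := grassmann_space V k) ([set U] `|` p)).
  by apply: (span_star_strong h1) => S [->//|[]].
have [Y [[[sY cY] _] nYW YU [A [YA [hA Ad]]]]] := reached lp npU st.
have [S YS nWS] : exists2 S, Y S & ~ W S.
  apply: contrapT => none; apply: nYW => S YS; apply: contrapT => nWS.
  by apply: none; exists S.
pose x : ipoint D := exist _ S nWS.
have [e|nSU] := pselect (S = U); first by left; exists x; rewrite /= e.
have [e|nSA] := pselect (S = A); first by left; exists x; rewrite /= e.
have nUA : emb U <> emb A by move=> e; apply: Ud; rewrite e.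
have UA := adjq_star h1 (level0 U) (level0 A) hU hA.
have SU := collinear_adjq (cY _ _ nSU YS YU).
have SA := collinear_adjq (cY _ _ nSA YS YA).
have [m1 _] := star_span h1 (level0 U) (level0 A) nUA hU hA.
have [hS|Sj] := tri (level0 U) (level0 A) (level0 S) nUA UA SU SA.
  by left; exists x; rewrite -m1.
by right; exists (emb A), x; split=> //; exact: level0.
Qed.

Lemma horizonE (U : Defs.Sub V k) : horizon (emb U) <-> W U.
Proof. by split=> [[S /emb_inj<-]|WU] //; exists U. Qed.

Lemma proper_lineE (p : iline D) :
  sval p = [set U : Defs.Sub V k | foot X p \sub emb U /\ emb U \sub roof X p].
Proof. by have [] := svalP (cid (line_coordinates (ltnW k_gt1) p)). Qed.

Lemma some_point : exists U : Defs.Sub V k, True.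
Proof.
have [|Z [_ _ dZ]] := vspace_of_dim (m := k) (sub0v {:V}).
  by rewrite dimv0; lia.
by move/eqP in dZ; exists (exist _ Z dZ).
Qed.

(** The coordinate map sends a bundle to its point, and a pair of bundles to the
line that joins their points. *)
Theorem bundles_recover : recovers bundle_interpretation W.
Proof.
have sr : stars_reached X by exact: grassmann_stars_reached.
have two : two_lines X by exact: two_linesP.
have [U0 _] := some_point.
have /choice[f0 f0P] : forall S : set (iline D), exists U : Defs.Sub V k,
    bundle S -> S = lines_at (emb U).
  move=> S; have [/(bundleE two)[u /point_of[U <-] ->]|nb] := pselect (bundle S).
    by exists U.
  by exists U0.
have bL (U : Defs.Sub V k) : bundle (lines_at (emb U)).
  exact: (bundle_lines_at two (level0 U)).
have fL (U : Defs.Sub V k) : f0 (lines_at (emb U)) = U.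
  by apply/emb_inj/esym/(bundle_inj two (level0 _) (level0 _))/f0P.
pose f (t : env D [:: LineSet]) : points (grassmann_space V k) := f0 t.1.
pose m S1 S2 : el X := emb (f0 S1) \cap emb (f0 S2).
pose j S1 S2 : el X := emb (f0 S1) \cup emb (f0 S2).
pose g (l : env D [:: LineSet; LineSet]) : set (points (grassmann_space V k)) :=
  [set U : Defs.Sub V k | m l.1 l.2.1 \sub emb U /\ emb U \sub j l.1 l.2.1].
pose pair (S1 S2 : set (iline D)) :=
  (bundle S1 /\ bundle S2) /\ ~ S1 = S2 /\ adj2 S1 S2.
have pairP S1 S2 : pair S1 S2 -> [/\ emb (f0 S1) <> emb (f0 S2),
    adjq (emb (f0 S1)) (emb (f0 S2)), lev (m S1 S2) = - 1 &
    lev (j S1 S2) = 1].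
  move=> [[b1 b2] [n a]].
  have nv : emb (f0 S1) <> emb (f0 S2).
    by move=> e; apply: n; rewrite (f0P _ b1) (f0P _ b2) e.
  have aq : adjq (emb (f0 S1)) (emb (f0 S2)).
    apply/(adj2E two sr (level0 _) (level0 _)).
    by rewrite -(f0P _ b1) -(f0P _ b2).
  by have [] := adjq_span (level0 _) (level0 _) nv aq.
have thirdP S1 S2 T : pair S1 S2 -> bundle T ->
    third S1 S2 T <-> m S1 S2 \sub emb (f0 T) /\ emb (f0 T) \sub j S1 S2.
  move=> pr bT; have [nv aq _ _] := pairP _ _ pr; have [[b1 b2] _] := pr.
  rewrite -(thirdE two sr (level0 _) (level0 _) (level0 _) nv aq).
  by rewrite -(f0P _ b1) -(f0P _ b2) -(f0P _ bT).
have mem (l : env D [:: LineSet; LineSet]) : g l (f0 l.1) /\ g l (f0 l.2.1).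
  by split; split; rewrite /m /j; lat.
exists f, g; split.
  by move=> U; exists (lines_at (emb U), tt); [exact: bL | exact: fL].
split.
  move=> t t' b b'; change (t.1 = t'.1 <-> f0 t.1 = f0 t'.1).
  by split=> [->//|e]; rewrite (f0P t.1 b) (f0P t'.1 b') e.
split.
  move=> l pr; have [_ _ m1 j1] := pairP _ _ pr; apply: lineP => //.
  by rewrite /m /j; lat.
split.
  move=> q lq; have [H [B [H1 B1 HB ->]]] := line_between lq.
  have dH : (\dim H).+1 = k by move/levelE: H1; lia.
  have dB : \dim B = k.+1 by move/levelE: B1; lia.
  have [U1 [U2 [e1 e2 U1B U2B]]] := two_between dH dB HB.
  exists (lines_at (emb U1), (lines_at (emb U2), tt)).
    split; first by split; exact: bL.
    split.
      move=> e; have /(bundle_inj two (level0 _) (level0 _)) eU := e.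
      by have := H1; rewrite -e1 (emb_inj eU) capvv -/(emb U2) level0.
    apply/(adj2E two sr (level0 _) (level0 _)).
    exact: (@adjq_top _ X _ _ _ B1 U1B U2B).
  by rewrite /g /m /j /= !fL e1 e2.
split.
  move=> l l' pr pr'.
  change (third l.1 l.2.1 l'.1 /\ third l.1 l.2.1 l'.2.1 <-> g l = g l').
  have [_ _ m1 j1] := pairP _ _ pr; have [nv' _ _ _] := pairP _ _ pr'.
  have [[b1 b2] _] := pr'.
  rewrite !thirdP //; split=> [[[a1 a2] [c1 c2]]|e].
    have [em _] := star_span m1 (level0 _) (level0 _) nv' a1 c1.
    have [ej _] := top_span j1 (level0 _) (level0 _) nv' a2 c2.
    by rewrite /g -em -ej.
  by have [] := mem l'; rewrite -e.
split.
  move=> t l b pr; exact: (thirdP l.1 l.2.1 t.1 pr b).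
split.
  move=> t b; change (~ proper_bundle t.1 <-> W (f0 t.1)).
  rewrite {1}(f0P t.1 b) (proper_bundleE two (level0 _)) horizonE.
  by split=> [/contrapT//|WU nW]; exact: nW.
split.
  move=> U t b; change (bundle_at U t.1 <-> f0 t.1 = sval U).
  rewrite (bundle_atE X); split=> [e|e]; last by rewrite (f0P t.1 b) e.
  by rewrite e; exact: fL.
move=> p l pr; change (l.1 p /\ l.2.1 p <-> g l = sval p).
have [nv aq m1 j1] := pairP _ _ pr; have [[b1 b2] _] := pr.
have onE S : bundle S -> S p <-> through (emb (f0 S)) p.
  by move=> b; rewrite {1}(f0P _ b).
have ep := proper_lineE p.
split=> [[/(onE _ b1)[h1 r1] /(onE _ b2)[h2 r2]]|e].
  have em : m l.1 l.2.1 = foot X p.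
    exact: meets_foot (level0 _) (level0 _) nv h1 h2.
  have ej : j l.1 l.2.1 = roof X p.
    exact: joins_roof (level0 _) (level0 _) nv r1 r2.
  by rewrite ep /g em ej.
have [g1 g2] := mem l; rewrite e ep in g1 g2.
by split; [apply/(onE _ b1) | apply/(onE _ b2)].
Qed.

End Recovery.

Local Close Scope chart_scope.
Local Close Scope ring_scope.

Theorem theorem5p1 :
  exists I : interpretation,
  forall (F : fieldType) (V : vectType F) (n k : nat)
         (W : set (points (grassmann_space V k))) (lambda : nat),
    \dim {: V} = n ->
    (1 < k)%N -> (k < n - 1)%N ->
    (0 < lambda)%N ->
    has_index W lambda ->
    (forall p : set (points (grassmann_space V k)), lines p ->
       `I_(2 * lambda + 2) #<= p) ->
    (forall (U : points (grassmann_space V k)) p, lines p -> ~ p U ->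
       strong (span_subspace ([set U] `|` p)) ->
       exists X, [/\ maximal_strong X, ~ X `<=` W, X U & X `&` p !=set0]) ->
    recovers I W.
Proof.
exists bundle_interpretation => F V n k W lambda dV k1 kn l0 [_ few] big reached.
apply: (bundles_recover k1 _ l0 few big reached).
by rewrite dV; lia.
Qed.
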